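(* For each $\ell\ge 3$ and each $n\ge 4$ one has $\Lambda_\sigma^n V_\ell=0$, where $V_\ell=V_{(\ell,0)}$ is the simple $(\ell+1)$-dimensional $U_q(gl_2(\mathbb{C}))$-module of highest weight $(\ell,0)$ and $\Lambda^n_\sigma V_\ell\subset V_\ell^{\otimes n}$ is its $n$-th braided exterior power.
   Context: $U_q(gl_2(\mathbb{C}))$ is the $\mathbb{C}(q)$-algebra generated by $E,F,K_\lambda$ ($\lambda\in\mathbb{Z}^2$) with $K_\lambda K_\mu=K_{\lambda+\mu}$, $K_0=1$, $K_\lambda E=q^{(\alpha|\lambda)}EK_\lambda$, $K_\lambda F=q^{-(\alpha|\lambda)}FK_\lambda$, $EF-FE=\frac{K_\alpha-K_{-\alpha}}{q-q^{-1}}$, where $\alpha=(1,-1)$ and $(\cdot|\cdot)$ is the standard inner product on $\mathbb{Z}^2$; coproduct $\Delta(E)=E\otimes1+K_\alpha\otimes E$, $\Delta(F)=F\otimes K_{-\alpha}+1\otimes F$, $\Delta(K_\lambda)=K_\lambda\otimes K_\lambda$. $\mathcal{O}_f$ is the category of finite-dimensional modules $V=\bigoplus_{\mu\in\mathbb{Z}^2}V(\mu)$ with $K_\lambda$ acting on $V(\mu)$ by $q^{(\lambda|\mu)}$. Simple objects are $V_{(\lambda_1,\lambda_2)}$, $\lambda_1\ge\lambda_2$ integers, of dimension $\lambda_1-\lambda_2+1$; $V_\ell:=V_{(\ell,0)}$. The braiding is $\mathcal{R}_{U,V}=\tau\circ R:U\otimes V\to V\otimes U$, $\tau$ the permutation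 of factors, $R=R_0R_1$ the universal $R$-matrix ($R\Delta=\Delta^{op}R$), with $R_0(u\otimes v)=q^{(\lambda|\mu)}u\otimes v$ on weight vectors of weights $\lambda,\mu$ and $R_1\in1\otimes1+\widehat{\bigoplus}_{k\ge1}\mathbb{C}(q)F^k\otimes E^k$. For $V$ in $\mathcal{O}_f$, $\mathcal{R}_{V,V}$ is diagonalizable with eigenvalues $\pm q^k$, $k\in\mathbb{Z}$; $\Lambda^2_\sigma V\subset V\otimes V$ is the span of eigenvectors with eigenvalues of the form $-q^k$. For $n\ge2$, $\Lambda^n_\sigma V=\bigcap_{i=1}^{n-1}V^{\otimes(i-1)}\otimes\Lambda^2_\sigma V\otimes V^{\otimes(n-1-i)}\subset V^{\otimes n}$. (Equivalently, $\Lambda^2_\sigma V_\ell$ is the sum of the submodules of $V_\ell\otimes V_\ell$ isomorphic to $V_{(2\ell-m,m)}$ with $m$ odd, $0\le m\le\ell$.) *)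

(* Defs.v *)
From HB Require Import structures.
From mathcomp Require Import all_boot all_order all_algebra.
From mathcomp Require Import fraction complex boolp classical_sets reals.
From mathcomp Require Import ring.

Set Implicit Arguments.
Unset Strict Implicit.
Unset Printing Implicit Defensive.

Import GRing.Theory.
Local Open Scope ring_scope.
Local Open Scope classical_set_scope.

Definition Cq (R : realType) : fieldType := {fraction {poly R[i]}}.
Definition qvar (R : realType) : Cq R := tofrac ('X : {poly R[i]}).

(* Finite-dimensional spaces are taken in coordinates: K^I for a finite type
   I, with K^I (x) K^J = K^(I * J). *)
Notation coordspace K I := {ffun I -> K^o}.

Section LinearAlgebra.
Variable K : fieldType.
Implicit Types I J : finType.

Definition lspan (V : lmodType K) (S : set V) : set V :=
  [set v | exists (m : nat) (a : 'I_m -> K) (s : 'I_m -> V),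
     (forall i, S (s i)) /\ v = \sum_i a i *: s i].

Definition stdvec I (i : I) : coordspace K I := [ffun k => (k == i)%:R].

Definition tens I J (u : coordspace K I) (v : coordspace K J) :
    coordspace K (I * J)%type := [ffun p => u p.1 * v p.2].

Definition tens_lfun I J (f : 'End(coordspace K I)) (g : 'End(coordspace K J)) :
    'End(coordspace K (I * J)%type) :=
  linfun (fun t : coordspace K (I * J)%type =>
    \sum_i \sum_j (t (i, j) : K) *: tens (f (stdvec i)) (g (stdvec j))).

Definition flip I J : 'Hom(coordspace K (I * J)%type, coordspace K (J * I)%type) :=
  linfun (fun t : coordspace K (I * J)%type =>
    [ffun p => t (p.2, p.1)] : coordspace K (J * I)%type).

Definition lfun_pow (V : vectType K) (f : 'End(V)) (k : nat) : 'End(V) :=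
  iter k (fun g => (f \o g)%VF) \1%VF.

(* The n-fold tensor power of K^I is K^(I^n), with I^n = {ffun 'I_n -> I}. *)
Notation tenspow I n := (coordspace K {ffun 'I_n -> I}).

(* The tensor v_0 (x) .. (x) w (x) .. (x) v_(n-1) with w in the slots i, j. *)
Definition tens_insert I n (i j : 'I_n) (w : coordspace K (I * I)%type)
    (v : 'I_n -> coordspace K I) : tenspow I n :=
  [ffun x : {ffun 'I_n -> I} =>
     w (x i, x j) * \prod_(k < n | (k != i) && (k != j)) v k (x k)].

(* For j = i + 1 this is V^(x) i (x) W (x) V^(x) (n - 2 - i), with V = K^I. *)
Definition tens_slot I n (i j : 'I_n) (W : set (coordspace K (I * I)%type)) :
    set (tenspow I n) :=
  lspan [set t | exists w v, W w /\ t = tens_insert i j w v].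

End LinearAlgebra.

Arguments lfun_pow : simpl never.

Notation tenspow K I n := (coordspace K {ffun 'I_n -> I}).

Definition weight := (int * int)%type.
Definition ip (l m : weight) : int := l.1 * m.1 + l.2 * m.2.
Definition alpha : weight := (1, -1).

Section QuantumGL2.
Variables (K : fieldType) (q : K).
Implicit Types I J : finType.

Record uqgl2_module I := UqGl2Module {
  opE : 'End(coordspace K I);
  opF : 'End(coordspace K I);
  opK : weight -> 'End(coordspace K I);
  opKD : forall l m, (opK l \o opK m)%VF = opK (l + m);
  opK0 : opK 0 = \1%VF;
  opKE : forall l, (opK l \o opE)%VF = q ^ ip alpha l *: (opE \o opK l)%VF;
  opKF : forall l, (opK l \o opF)%VF = q ^ (- ip alpha l) *: (opF \o opK l)%VF;
  opEF : (opE \o opF)%VF - (opF \o opE)%VF =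
           (q - q^-1)^-1 *: (opK alpha - opK (- alpha))
}.

Definition weight_space I (M : uqgl2_module I) (m : weight) :
    set (coordspace K I) :=
  [set v | forall l, opK M l v = q ^ ip l m *: v].

(* Membership in O_f. The sum of the weight spaces is automatically direct
   when q is not a root of unity. *)
Definition in_Of I (M : uqgl2_module I) : Prop :=
  lspan (\bigcup_m weight_space M m) = setT.

Definition submodule I (M : uqgl2_module I) (W : {vspace coordspace K I}) : Prop :=
  [/\ (opE M @: W <= W)%VS, (opF M @: W <= W)%VS
    & forall l, (opK M l @: W <= W)%VS].

Definition simple_module I (M : uqgl2_module I) : Prop :=
  (fullv : {vspace coordspace K I}) <> 0%VS /\
  forall W : {vspace coordspace K I}, submodule M W -> W = 0%VS \/ W = fullv.

Definition has_highest_weight I (M : uqgl2_module I) (m : weight) : Prop :=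
  exists v, [/\ v <> 0, weight_space M m v & opE M v = 0].

Section Pair.
Variables (I J : finType) (M : uqgl2_module I) (N : uqgl2_module J).
Local Notation "f ⊗ g" := (tens_lfun f g) (at level 40, left associativity).

Definition DeltaE := (opE M ⊗ \1%VF) + (opK M alpha ⊗ opE N).
Definition DeltaF := (opF M ⊗ opK N (- alpha)) + (\1%VF ⊗ opF N).
Definition DeltaK l := opK M l ⊗ opK N l.
Definition DeltaopE := (\1%VF ⊗ opE N) + (opE M ⊗ opK N alpha).
Definition DeltaopF := (opK M (- alpha) ⊗ opF N) + (opF M ⊗ \1%VF).
Definition DeltaopK l := opK M l ⊗ opK N l.

Definition R0_spec (f : 'End(coordspace K (I * J)%type)) : Prop :=
  forall l m u v, weight_space M l u -> weight_space N m v ->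
    f (tens u v) = q ^ ip l m *: tens u v.

(* For M, N in O_f exactly one operator satisfies R0_spec: see R0P and
   tens_ext. *)
Definition R0 : 'End(coordspace K (I * J)%type) :=
  xget 0 [set f | R0_spec f].

(* R_1 = \sum_k c_k F^k (x) E^k; on O_f the terms with k >= #|I| = dim M
   vanish, see opF_nilp. *)
Definition R1 (c : nat -> K) : 'End(coordspace K (I * J)%type) :=
  \sum_(k < #|I|) c k *: (lfun_pow (opF M) k ⊗ lfun_pow (opE N) k).

Definition Rmat (c : nat -> K) := (R0 \o R1 c)%VF.

Definition braiding (c : nat -> K) :
    'Hom(coordspace K (I * J)%type, coordspace K (J * I)%type) :=
  (flip K I J \o Rmat c)%VF.

End Pair.

(* R_0 R_1 with coefficients c_k is a universal R-matrix; such a c exists, see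
   universal_R_exists. *)
Definition universal_R (c : nat -> K) : Prop :=
  c 0%N = 1 /\
  forall I J (M : uqgl2_module I) (N : uqgl2_module J), in_Of M -> in_Of N ->
    [/\ (Rmat M N c \o DeltaE M N)%VF = (DeltaopE M N \o Rmat M N c)%VF,
        (Rmat M N c \o DeltaF M N)%VF = (DeltaopF M N \o Rmat M N c)%VF
      & forall l, (Rmat M N c \o DeltaK M N l)%VF =
                  (DeltaopK M N l \o Rmat M N c)%VF].

Definition ext_square (c : nat -> K) I (M : uqgl2_module I) :
    set (coordspace K (I * I)%type) :=
  lspan [set w | exists k : int, braiding M M c w = (- q ^ k) *: w].

Definition ext_power (c : nat -> K) I (M : uqgl2_module I) (n : nat) :
    set (tenspow K I n) :=
  [set t | forall i j : 'I_n, j = i.+1 :> nat ->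
     tens_slot i j (ext_square c M) t].

Arguments ext_power c {I} M n _.

End QuantumGL2.

Arguments ext_power {K q} c {I} M n _.

Section TensorFacts.
Variable K : fieldType.
Implicit Types I J : finType.

Lemma tens_lfun_linear I J (f : 'End(coordspace K I)) (g : 'End(coordspace K J)) :
  linear (fun t : coordspace K (I * J)%type =>
    \sum_i \sum_j (t (i, j) : K) *: tens (f (stdvec K i)) (g (stdvec K j))).
Proof.
move=> a s t; rewrite scaler_sumr -big_split; apply: eq_bigr => i _ /=.
rewrite scaler_sumr -big_split; apply: eq_bigr => j _ /=.
by rewrite !ffunE scalerDl scalerA.
Qed.

Lemma stdvecE I (u : coordspace K I) : u = \sum_i (u i : K) *: stdvec K i.
Proof.
apply/ffunP => k; rewrite sum_ffunE (bigD1 k) //= !ffunE eqxx big1 => [|i nik].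
  by rewrite addr0 /GRing.scale /= mulr1.
by rewrite !ffunE eq_sym (negbTE nik) scaler0.
Qed.

Lemma tens_bilin I J n m (a : 'I_n -> K) (b : 'I_m -> K) (u : 'I_n -> coordspace K I)
    (v : 'I_m -> coordspace K J) :
  tens (\sum_i a i *: u i) (\sum_j b j *: v j) =
  \sum_i \sum_j (a i * b j) *: tens (u i) (v j).
Proof.
apply/ffunP => p; rewrite !ffunE !sum_ffunE mulr_suml; apply: eq_bigr => i _.
rewrite sum_ffunE mulr_sumr; apply: eq_bigr => j _.
by rewrite !ffunE /GRing.scale /= mulrACA.
Qed.

Lemma tensZ I J a b (u : coordspace K I) (v : coordspace K J) :
  tens (a *: u) (b *: v) = (a * b) *: tens u v.
Proof. by apply/ffunP => p; rewrite !ffunE /GRing.scale /= mulrACA. Qed.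

Lemma tensZl I J a (u : coordspace K I) (v : coordspace K J) :
  tens (a *: u) v = a *: tens u v.
Proof. by apply/ffunP => p; rewrite !ffunE /GRing.scale /= mulrA. Qed.

Lemma tensZr I J a (u : coordspace K I) (v : coordspace K J) :
  tens u (a *: v) = a *: tens u v.
Proof. by apply/ffunP => p; rewrite !ffunE /GRing.scale /= mulrCA. Qed.

Lemma tensDl I J (u u' : coordspace K I) (v : coordspace K J) :
  tens (u + u') v = tens u v + tens u' v.
Proof. by apply/ffunP => p; rewrite !ffunE mulrDl. Qed.

Lemma tensDr I J (u : coordspace K I) (v v' : coordspace K J) :
  tens u (v + v') = tens u v + tens u v'.
Proof. by apply/ffunP => p; rewrite !ffunE mulrDr. Qed.

Lemma tensNl I J (u : coordspace K I) (v : coordspace K J) :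
  tens (- u) v = - tens u v.
Proof. by apply/ffunP => p; rewrite !ffunE mulNr. Qed.

Lemma tensNr I J (u : coordspace K I) (v : coordspace K J) :
  tens u (- v) = - tens u v.
Proof. by apply/ffunP => p; rewrite !ffunE mulrN. Qed.

Lemma tens0l I J (v : coordspace K J) : tens (0 : coordspace K I) v = 0.
Proof. by apply/ffunP => p; rewrite !ffunE mul0r. Qed.

Lemma tens0r I J (u : coordspace K I) : tens u (0 : coordspace K J) = 0.
Proof. by apply/ffunP => p; rewrite !ffunE mulr0. Qed.

Lemma tens_lfunE I J (f : 'End(coordspace K I)) (g : 'End(coordspace K J)) u v :
  tens_lfun f g (tens u v) = tens (f u) (g v).
Proof.
pose L := GRing.isLinear.Build _ _ _ _ _ (tens_lfun_linear f g).
pose phi : {linear _ -> _} := HB.pack (fun t : coordspace K (I * J)%type =>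
    \sum_i \sum_j (t (i, j) : K) *: tens (f (stdvec K i)) (g (stdvec K j))) L.
rewrite [LHS](lfunE phi) /=.
rewrite [in RHS](stdvecE u) [in RHS](stdvecE v) !linear_sum.
apply/ffunP => p; rewrite [RHS]ffunE !sum_ffunE mulr_suml; apply: eq_bigr => i _.
rewrite sum_ffunE mulr_sumr; apply: eq_bigr => j _.
by rewrite !linearZ !ffunE /GRing.scale /= mulrACA.
Qed.

Lemma lfun_powS (V : vectType K) (f : 'End(V)) k u :
  lfun_pow f k.+1 u = f (lfun_pow f k u).
Proof. by rewrite /lfun_pow iterS comp_lfunE. Qed.

Lemma lfun_pow0 (V : vectType K) (f : 'End(V)) u : lfun_pow f 0 u = u.
Proof. by rewrite /lfun_pow /= id_lfunE. Qed.

Lemma subseq_basis (V : vectType K) (X : seq V) :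
  exists Y, [/\ {subset Y <= X}, free Y & <<Y>>%VS = <<X>>%VS].
Proof.
elim: X => [|x X [Y [sY fY eY]]]; first by exists [::]; rewrite nil_free.
case: (boolP (x \in <<Y>>%VS)) => xY.
  exists Y; split=> // [y /sY|]; first by rewrite inE orbC => ->.
  rewrite span_cons -eY; apply/esym/addv_idPr.
  by rewrite -memvE.
exists (x :: Y); split; last by rewrite !span_cons eY.
  by move=> y; rewrite !inE => /orP[->//|/sY ->]; rewrite orbT.
by rewrite free_cons xY.
Qed.

Lemma free_eigen (V : vectType K) (f : 'End(V)) (a : nat -> K) (x : nat -> V) m :
  injective a -> (forall k, f (x k) = a k *: x k) ->
  (forall k, (k < m)%N -> x k != 0) -> free [seq x k | k <- rev (iota 0 m)].
Proof.
move=> ia fx; elim: m => [|m IH] nz; first by rewrite nil_free.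
rewrite -addn1 iotaD rev_cat /= free_cons IH => [|k km]; last by apply: nz; rewrite ltnW.
rewrite andbT add0n; apply/negP => xin.
set Y := [seq x k | k <- rev (iota 0 m)] in xin *.
have fY : free Y by apply: IH => k km; apply: nz; rewrite ltnW.
have sY : size Y = m by rewrite size_map size_rev size_iota.
have xinT : x m \in <<in_tuple Y>>%VS by [].
have e := coord_span xinT.
have hY (i : 'I_(size Y)) : (in_tuple Y)`_i = x (nth 0%N (rev (iota 0 m)) i).
  by rewrite /= (nth_map 0%N) // -(size_map x).
pose k (i : 'I_(size Y)) := nth 0%N (rev (iota 0 m)) i.
have km i : k i != m.
  have : k i \in rev (iota 0 m) by rewrite mem_nth // -(size_map x).
  by rewrite mem_rev mem_iota add0n /= ltn_neqAle => /andP[].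
have : \sum_i (coord (in_tuple Y) i (x m) * (a (k i) - a m)) *: (in_tuple Y)`_i = 0.
  have : f (x m) - a m *: x m = 0 by rewrite fx subrr.
  rewrite {1 2}e linear_sum scaler_sumr -sumrB => hz; rewrite -[RHS]hz; apply: eq_bigr => i _.
  by rewrite linearZ /= hY fx !scalerA -scalerBl mulrBr [a m * _]mulrC.
move/freeP: (fY : free (in_tuple Y)) => /[apply] z.
have : x m = 0.
  rewrite e big1 // => i _; have /eqP := z i.
  rewrite mulf_eq0 subr_eq0 (inj_eq ia) (negbTE (km i)) orbF => /eqP ->.
  by rewrite scale0r.
by apply/eqP/nz.
Qed.

End TensorFacts.

Section RmatrixFacts.
Variables (K : fieldType) (q : K).
Hypothesis q0 : q != 0.
Implicit Types I J : finType.

Lemma ipC l m : ip l m = ip m l.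
Proof. by rewrite /ip mulrC [l.2 * _]mulrC. Qed.
Lemma ipDl l m r : ip (l + m) r = ip l r + ip m r.
Proof. by rewrite /ip /= !mulrDl addrACA. Qed.
Lemma ipNl l r : ip (- l) r = - ip l r.
Proof. by rewrite /ip /= !mulNr opprD. Qed.
Lemma ipDr l m r : ip r (l + m) = ip r l + ip r m.
Proof. by rewrite !(ipC r) ipDl. Qed.
Lemma ipNr l r : ip r (- l) = - ip r l.
Proof. by rewrite !(ipC r) ipNl. Qed.
Lemma ip_alpha : ip alpha alpha = 2. Proof. by []. Qed.

Section OneModule.
Variables (I : finType) (M : uqgl2_module q I).
Local Notation V := (coordspace K I).

Lemma weight_basis : in_Of M ->
  exists (n : nat) (b : n.-tuple V) (wt : 'I_n -> weight),
    basis_of fullv b /\ forall i, weight_space M (wt i) b`_i.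
Proof.
move=> hO.
have hs (s : seq V) : exists X : seq V, (forall x, x \in X -> exists m, weight_space M m x)
    /\ {subset s <= <<X>>%VS}.
  elim: s => [|v s [X [hX sX]]]; first by exists [::].
  have : lspan (\bigcup_m weight_space M m) v by rewrite hO.
  move=> [m [a [t [ht ev]]]].
  exists ([seq t i | i <- enum 'I_m] ++ X); split=> x.
    rewrite mem_cat => /orP[/mapP[i _ ->]|/hX//].
    by have [w _ hw] := ht i; exists w.
  rewrite inE span_cat => /orP[/eqP->|/sX xX]; last first.
    by apply: subvP xX; apply: addvSr.
  apply: (subvP (addvSl _ _)); rewrite ev; apply: memv_suml => i _.
  by apply/memvZ/memv_span/map_f; rewrite mem_enum.
have [X [hX sX]] := hs (vbasis (fullv : {vspace V})).
have [Y [sY fY eY]] := subseq_basis X.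
have bY : basis_of fullv (in_tuple Y).
  rewrite basisEdim /=; apply/andP; split; last first.
    by move: fY; rewrite /free => /eqP <-; apply: dimvS; apply: subvf.
  rewrite eY; apply/subvP => v _; rewrite (coord_vbasis (memvf v)).
  by apply: memv_suml => i _; apply/memvZ/sX/mem_nth; rewrite size_tuple.
have /choice [wt hwt] (i : 'I_(size Y)) : exists m, weight_space M m (in_tuple Y)`_i.
  by apply/hX/sY/mem_nth.
by exists (size Y), (in_tuple Y), wt.
Qed.

Lemma weight_coord (n : nat) (b : n.-tuple V) (wt : 'I_n -> weight) l u i :
  basis_of fullv b -> (forall i, weight_space M (wt i) b`_i) -> weight_space M l u ->
  coord b i u != 0 -> forall m, q ^ ip m (wt i) = q ^ ip m l.
Proof.
move=> hb hw hu nz m.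
have := congr1 (coord b i) (hu m).
rewrite linearZ /= {1}(coord_basis hb (memvf u)) !linear_sum /=.
rewrite (bigD1 i) //= big1 => [|j nji].
  rewrite !linearZ /= hw !linearZ /= coord_free ?eqxx ?(basis_free hb) //=.
  rewrite addr0 /GRing.scale /= mulr1 mulrC => h.
  exact: (mulIf nz).
rewrite !linearZ /= hw linearZ /= coord_free ?(basis_free hb) //.
by rewrite (negbTE nji) /GRing.scale /= !mulr0.
Qed.

Lemma weightE l u : weight_space M l u -> weight_space M (l + alpha) (opE M u).
Proof.
move=> hu m; rewrite -comp_lfunE opKE scale_lfunE comp_lfunE hu linearZ /= scalerA.
by rewrite -expfzDr // ipDr addrC (ipC alpha).
Qed.

Lemma weightF l u : weight_space M l u -> weight_space M (l - alpha) (opF M u).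
Proof.
move=> hu m; rewrite -comp_lfunE opKF scale_lfunE comp_lfunE hu linearZ /= scalerA.
by rewrite -expfzDr // ipDr ipNr addrC (ipC alpha).
Qed.

Lemma weightEk l u k : weight_space M l u ->
  weight_space M (l + alpha *+ k) (lfun_pow (opE M) k u).
Proof.
move=> hu; elim: k => [|k IH]; first by rewrite lfun_pow0 addr0.
by rewrite lfun_powS mulrSr addrA; apply: weightE.
Qed.

Lemma weightFk l u k : weight_space M l u ->
  weight_space M (l - alpha *+ k) (lfun_pow (opF M) k u).
Proof.
move=> hu; elim: k => [|k IH]; first by rewrite lfun_pow0 subr0.
by rewrite lfun_powS mulrSr opprD addrA; apply: weightF.
Qed.

End OneModule.

Lemma ip_alphaMn k : ip alpha (alpha *+ k) = (k%:Z *+ 2).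
Proof.
elim: k => [|k IH]; first by rewrite mulr0n.
by rewrite mulrSr ipDr IH ip_alpha intS mulrnDl addrC.
Qed.

Section TwoModules.
Variables (I J : finType) (M : uqgl2_module q I) (N : uqgl2_module q J).
Hypotheses (hM : in_Of M) (hN : in_Of N).

Lemma tens_ext (W : vectType K) (f g : 'Hom(coordspace K (I * J)%type, W)) :
  (forall l m u v, weight_space M l u -> weight_space N m v ->
     f (tens u v) = g (tens u v)) -> f = g.
Proof.
move=> h; apply/lfunP => t; apply/eqP; rewrite -subr_eq0 -opp_lfunE -add_lfunE.
have -> : t = \sum_(p : I * J) (t p : K) *: tens (stdvec K p.1) (stdvec K p.2).
  rewrite [LHS]stdvecE; apply: eq_bigr => -[i j] _; congr (_ *: _).
  by apply/ffunP => -[i' j']; rewrite !ffunE /= xpair_eqE -natrM mulnb.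
rewrite linear_sum big1 // => -[i j] _; rewrite linearZ /=.
move: (stdvec K i) (stdvec K j) => u v.
have : lspan (\bigcup_m weight_space M m) u by rewrite hM.
have : lspan (\bigcup_m weight_space N m) v by rewrite hN.
move=> [n [a [s [hs ->]]]] [n' [a' [s' [hs' ->]]]].
rewrite tens_bilin !linear_sum big1 ?scaler0 //= => k _.
rewrite !linear_sum big1 //= => k' _.
have [m _ hm] := hs k'; have [l _ hl] := hs' k.
rewrite linearZ /= add_lfunE opp_lfunE (h _ _ _ _ hl hm) subrr.
by rewrite !scaler0.
Qed.

Lemma R0_exists : exists f, R0_spec M N f.
Proof.
have [n [b [wt [hb hw]]]] := weight_basis hM.
have [n' [b' [wt' [hb' hw']]]] := weight_basis hN.
pose P i : 'End(coordspace K I) := linfun (fun u => coord b i u *: b`_i).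
pose P' i : 'End(coordspace K J) := linfun (fun u => coord b' i u *: b'`_i).
have PE i u : P i u = coord b i u *: b`_i.
  have L : linear (fun u => coord b i u *: b`_i).
    by move=> a x y; rewrite linearP /= scalerDl scalerA.
  pose phi : {linear _ -> _} := HB.pack (fun u => coord b i u *: b`_i)
    (GRing.isLinear.Build _ _ _ _ _ L).
  exact: (lfunE phi).
have PE' i u : P' i u = coord b' i u *: b'`_i.
  have L : linear (fun u => coord b' i u *: b'`_i).
    by move=> a x y; rewrite linearP /= scalerDl scalerA.
  pose phi : {linear _ -> _} := HB.pack (fun u => coord b' i u *: b'`_i)
    (GRing.isLinear.Build _ _ _ _ _ L).
  exact: (lfunE phi).
exists (\sum_i \sum_j q ^ ip (wt i) (wt' j) *: tens_lfun (P i) (P' j)).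
move=> l m u v hu hv.
rewrite [in RHS](coord_basis hb (memvf u)) [in RHS](coord_basis hb' (memvf v)).
rewrite tens_bilin sum_lfunE scaler_sumr; apply: eq_bigr => i _.
rewrite sum_lfunE scaler_sumr; apply: eq_bigr => j _.
rewrite scale_lfunE tens_lfunE PE PE' tensZ.
have [->|nz] := eqVneq (coord b i u) 0; first by rewrite mul0r !scale0r !scaler0.
have [->|nz'] := eqVneq (coord b' j v) 0; first by rewrite mulr0 !scale0r !scaler0.
congr (_ *: _).
rewrite ipC (weight_coord hb hw hu nz) ipC.
exact: (weight_coord hb' hw' hv nz').
Qed.

Lemma R0P : R0_spec M N (R0 M N).
Proof. exact: (xgetPex 0 R0_exists). Qed.

End TwoModules.

Hypothesis q_inf : forall m : int, q ^ m = 1 -> m = 0.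

Lemma q_inj : injective (fun m : int => q ^ m).
Proof.
move=> m n e; apply/eqP; rewrite -subr_eq0; apply/eqP/q_inf.
by rewrite expfzDr // e -expfzDr // subrr.
Qed.

Lemma opF_nilp I (M : uqgl2_module q I) l u : weight_space M l u ->
  lfun_pow (opF M) #|I| u = 0.
Proof.
move=> hu; apply/eqP/negPn/negP => nz.
have nzk k : (k < #|I|.+1)%N -> lfun_pow (opF M) k u != 0.
  rewrite ltnS => hk; apply: contra nz => /eqP e.
  rewrite -(subnK hk); elim: (#|I| - k)%N => [|r IH]; first by rewrite add0n e.
  by rewrite addSn lfun_powS (eqP IH) linear0.
have := @free_eigen _ _ (opK M alpha) (fun k => q ^ ip alpha (l - alpha *+ k))
  (fun k => lfun_pow (opF M) k u) _ _ _ nzk.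
move=> -/(_ _ _)/wrap[].
- move=> k k' /q_inj; rewrite !ipDr !ipNr !ip_alphaMn => /addrI/oppr_inj.
  rewrite -[k%:Z *+ 2]mulr_natr -[k'%:Z *+ 2]mulr_natr => /mulIf h; apply/eqP; rewrite -eqz_nat; apply/eqP/h.
  by [].
- by move=> k; apply: weightFk.
rewrite /free => /eqP d.
have := dimvS (subvf <<[seq lfun_pow (opF M) k u | k <- rev (iota 0 #|I|.+1)]>>).
rewrite d size_map size_rev size_iota dimvf /dim /= muln1.
by rewrite ltnn.
Qed.

Definition qbr (m : int) : K := (q ^ m - q ^ (- m)) / (q - q^-1).

Definition Rcoef (k : nat) : K :=
  \prod_(j < k) (q ^+ j * (q - q^-1) / qbr j.+1).

Lemma qqV0 : q - q^-1 != 0.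
Proof.
rewrite subr_eq0; apply/eqP => e.
suff : (2 : int) = 0 by [].
by apply: q_inf; rewrite -exprnP expr2 {1}e mulVf.
Qed.

Lemma qbr0 (k : nat) : qbr k.+1 != 0.
Proof.
rewrite mulf_neq0 ?invr_eq0 ?qqV0 // subr_eq0; apply/eqP => /q_inj.
by move/eqP; rewrite -subr_eq0 opprK.
Qed.

Lemma RcoefS k : Rcoef k.+1 * qbr k.+1 = Rcoef k * q ^+ k * (q - q^-1).
Proof.
rewrite /Rcoef big_ord_recr /= -mulrA divfK ?qbr0 //.
by rewrite !mulrA.
Qed.

Lemma opEFw I (M : uqgl2_module q I) l u : weight_space M l u ->
  opE M (opF M u) = opF M (opE M u) + qbr (ip alpha l) *: u.
Proof.
move=> hu; apply/eqP; rewrite addrC -subr_eq -!comp_lfunE.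
rewrite -opp_lfunE -add_lfunE opEF scale_lfunE add_lfunE opp_lfunE !hu.
by rewrite ipNl -scalerBl scalerA mulrC.
Qed.

Lemma qbr_rec (m k : int) :
  qbr k * qbr (m - k + 1) + qbr (m - k - k) = qbr (k + 1) * qbr (m - (k + 1) + 1).
Proof.
rewrite /qbr !(opprD, opprK) !expfzDr // -!invr_expz !expr1z.
have hk : q ^ k != 0 by rewrite expfz_neq0.
have hm : q ^ m != 0 by rewrite expfz_neq0.
have := qqV0.
move: (q ^ k) (q ^ m) hk hm => x y hx hy h.
have h2 : q ^+ 2 - 1 != 0.
  apply: contra h => /eqP e; apply/eqP.
  by apply: (mulfI q0); rewrite mulr0 mulrBr mulfV // -expr2.
field.
by rewrite q0 hx hy h2.
Qed.

Lemma qbr_recE (m k : int) :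
  qbr k * qbr (m + k - 1) + qbr (m + k + k) = qbr (k + 1) * qbr (m + k).
Proof.
rewrite /qbr !(opprD, opprK) !expfzDr // -!invr_expz !expr1z.
have hk : q ^ k != 0 by rewrite expfz_neq0.
have hm : q ^ m != 0 by rewrite expfz_neq0.
have := qqV0.
move: (q ^ k) (q ^ m) hk hm => x y hx hy h.
have h2 : q ^+ 2 - 1 != 0.
  apply: contra h => /eqP e; apply/eqP.
  by apply: (mulfI q0); rewrite mulr0 mulrBr mulfV // -expr2.
field.
by rewrite q0 hx hy h2.
Qed.

Lemma qbr1 : qbr 1 = 1.
Proof. by rewrite /qbr expr1z -invr_expz expr1z divff ?qqV0. Qed.

Lemma opEFk I (M : uqgl2_module q I) l u (k : nat) : weight_space M l u ->
  opE M (lfun_pow (opF M) k.+1 u) = lfun_pow (opF M) k.+1 (opE M u) +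
    (qbr k.+1 * qbr (ip alpha l - k.+1%:Z + 1)) *: lfun_pow (opF M) k u.
Proof.
move=> hu; elim: k => [|k IH].
  rewrite !lfun_powS !lfun_pow0 (opEFw hu) subrK; congr (_ + _ *: _).
  by rewrite (_ : qbr 1%N = 1) ?mul1r //; exact: qbr1.
rewrite lfun_powS (opEFw (weightFk k.+1 hu)) IH linearD linearZ /= -!lfun_powS -addrA.
congr (_ + _).
rewrite -scalerDl; congr (_ *: _).
rewrite ipDr ipNr ip_alphaMn mulr2n opprD addrA.
by rewrite qbr_rec -[k.+2]addn1 PoszD.
Qed.

Lemma opFEk I (M : uqgl2_module q I) l u (k : nat) : weight_space M l u ->
  lfun_pow (opE M) k.+1 (opF M u) = opF M (lfun_pow (opE M) k.+1 u) +
    (qbr k.+1 * qbr (ip alpha l + k%:Z)) *: lfun_pow (opE M) k u.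
Proof.
move=> hu; elim: k => [|k IH].
  rewrite !lfun_powS !lfun_pow0 (opEFw hu) addr0; congr (_ + _ *: _).
  by rewrite (_ : qbr 1%N = 1) ?mul1r //; exact: qbr1.
rewrite lfun_powS IH linearD linearZ /= (opEFw (weightEk k.+1 hu)) -!lfun_powS -addrA.
congr (_ + _); rewrite -scalerDl; congr (_ *: _).
have e : k%:Z = k.+1%:Z - 1 by rewrite -[k.+1]addn1 PoszD addrK.
rewrite ipDr ip_alphaMn mulr2n addrA e !addrA.
by rewrite [LHS]addrC qbr_recE -[k.+2]addn1 PoszD.
Qed.

Lemma RcoefSq (k : nat) (x : int) :
  Rcoef k.+1 * (qbr k.+1 * qbr x) = Rcoef k * (q ^ (k%:Z + x) - q ^ (k%:Z - x)).
Proof.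
rewrite mulrA RcoefS -!mulrA; congr (_ * _).
by rewrite [qbr x]mulrC mulVKf ?qqV0 // mulrBr !expfzDr.
Qed.

Lemma lfun_powSr (V : vectType K) (f : 'End(V)) k u :
  lfun_pow f k (f u) = lfun_pow f k.+1 u.
Proof.
elim: k => [|k IH]; first by rewrite lfun_powS !lfun_pow0.
by rewrite lfun_powS IH -lfun_powS.
Qed.

Lemma sum_shift (V : zmodType) n (G : nat -> V) :
  G 0%N = 0 -> G n = 0 -> \sum_(k < n) G k = \sum_(k < n) G k.+1.
Proof.
move=> G0 Gn; have : \sum_(k < n.+1) G k = \sum_(k < n.+1) G k by [].
by rewrite {1}big_ord_recr big_ord_recl /= G0 Gn add0r addr0.
Qed.

Lemma addr_swap (V : zmodType) (x y z w : V) : w - x = y - z -> x + y = z + w.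
Proof. by move=> h; rewrite -(subrK z y) -h addrA (addrC x) subrK addrC. Qed.

Lemma Rcoef_universal : universal_R q Rcoef.
Proof.
split; first by rewrite /Rcoef big_ord0.
move=> I J M N hM hN.
have R0w := R0P hM hN.
have R1E u v : R1 M N Rcoef (tens u v) =
    \sum_(k < #|I|) Rcoef k *: tens (lfun_pow (opF M) k u) (lfun_pow (opE N) k v).
  rewrite sum_lfunE; apply: eq_bigr => k _.
  by rewrite scale_lfunE tens_lfunE.
have R0E : (R0 M N \o (tens_lfun (opK M (- alpha)) (opE N) + tens_lfun (opE M) \1%VF))%VF
    = (DeltaopE M N \o R0 M N)%VF.
  apply: (tens_ext hM hN) => l m u v hu hv; rewrite /DeltaopE /DeltaopF.
  rewrite !comp_lfunE (R0w _ _ _ _ hu hv) linearZ /= !add_lfunE !tens_lfunE.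
  rewrite !id_lfunE hu hv tensZl tensZr linearD linearZ /=.
  rewrite (R0w _ _ _ _ hu (weightE hv)) (R0w _ _ _ _ (weightE hu) hv).
  rewrite scalerDr !scalerA -!expfzDr //; congr (_ *: _ + _ *: _); congr (_ ^ _).
    by rewrite ipNl ipDr (ipC l alpha) [ip l m + _]addrC addKr.
  by rewrite ipDl.
have R0F : (R0 M N \o (tens_lfun \1%VF (opF N) + tens_lfun (opF M) (opK N alpha)))%VF
    = (DeltaopF M N \o R0 M N)%VF.
  apply: (tens_ext hM hN) => l m u v hu hv; rewrite /DeltaopE /DeltaopF.
  rewrite !comp_lfunE (R0w _ _ _ _ hu hv) linearZ /= !add_lfunE !tens_lfunE.
  rewrite !id_lfunE hu hv tensZl tensZr linearD linearZ /=.
  rewrite (R0w _ _ _ _ hu (weightF hv)) (R0w _ _ _ _ (weightF hu) hv).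
  rewrite scalerDr !scalerA -!expfzDr //; congr (_ *: _ + _ *: _); congr (_ ^ _).
    by rewrite ipNl ipDr ipNr (ipC l alpha).
  by rewrite ipDl ipNl addrC subrK.
have nF x w : weight_space M w x -> lfun_pow (opF M) #|I| x = 0 by apply: opF_nilp.
have R1EE : (R1 M N Rcoef \o DeltaE M N)%VF =
    ((tens_lfun (opK M (- alpha)) (opE N) + tens_lfun (opE M) \1%VF) \o R1 M N Rcoef)%VF.
  apply: (tens_ext hM hN) => l m u v hu hv; rewrite /DeltaE.
  pose G k := Rcoef k *: tens (opE M (lfun_pow (opF M) k u)
    - lfun_pow (opF M) k (opE M u)) (lfun_pow (opE N) k v).
  rewrite !comp_lfunE !add_lfunE !tens_lfunE linearD /= !id_lfunE hu !R1E.
  rewrite !linear_sum /=; apply: addr_swap; rewrite -!sumrB.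
  transitivity (\sum_(k < #|I|) G k).
    apply: eq_bigr => k _; rewrite linearZ /= tens_lfunE id_lfunE.
    by rewrite /G tensDl tensNl scalerBr.
  rewrite sum_shift; last 2 first.
  - by rewrite /G !lfun_pow0 subrr tens0l scaler0.
  - by rewrite /G (nF _ _ hu) (nF _ _ (weightE hu)) linear0 subrr tens0l scaler0.
  apply: eq_bigr => k _.
  rewrite /G (opEFk k hu) addrC addKr tensZl scalerA RcoefSq.
  rewrite !linearZ /= tens_lfunE (weightFk k hu) !tensZl lfun_powSr -lfun_powS.
  rewrite ?scalerN !scalerA -scalerBl -mulrBr; congr ((_ * (q ^ _ - q ^ _)) *: _).
  - by rewrite -[k.+1]addn1 PoszD; ring.
  - by rewrite ipNl ipDr ipNr ip_alphaMn -[k.+1]addn1 PoszD; ring.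
have R1FF : (R1 M N Rcoef \o DeltaF M N)%VF =
    ((tens_lfun \1%VF (opF N) + tens_lfun (opF M) (opK N alpha)) \o R1 M N Rcoef)%VF.
  apply: (tens_ext hM hN) => l m u v hu hv; rewrite /DeltaF.
  pose G k := Rcoef k *: tens (lfun_pow (opF M) k u)
     (lfun_pow (opE N) k (opF N v) - opF N (lfun_pow (opE N) k v)).
  rewrite !comp_lfunE !add_lfunE !tens_lfunE linearD /= !id_lfunE hv !R1E.
  rewrite !linear_sum /=; apply/esym/addr_swap; rewrite -!sumrB.
  transitivity (\sum_(k < #|I|) G k).
    apply: eq_bigr => k _; rewrite linearZ /= tens_lfunE id_lfunE.
    by rewrite /G tensDr tensNr scalerBr.
  rewrite sum_shift; last 2 first.
  - by rewrite /G !lfun_pow0 subrr tens0r scaler0.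
  - by rewrite /G (nF _ _ hu) tens0l scaler0.
  apply: eq_bigr => k _.
  rewrite /G (opFEk k hv) addrC addKr tensZr scalerA RcoefSq.
  rewrite !linearZ /= tens_lfunE (weightEk k hv) !tensZr lfun_powSr -lfun_powS.
  rewrite ?scalerN !scalerA -scalerBl -mulrBr; congr ((_ * (q ^ _ - q ^ _)) *: _).
  - by rewrite ipDr ip_alphaMn; ring.
  - by rewrite ipNl; ring.
split; rewrite /Rmat.
- by rewrite -comp_lfunA R1EE !comp_lfunA R0E.
- by rewrite -comp_lfunA R1FF !comp_lfunA R0F.
move=> r; apply: (tens_ext hM hN) => l m u v hu hv.
rewrite !comp_lfunE tens_lfunE hu hv tensZ !linearZ /= R1E.
rewrite !linear_sum /=; apply: eq_bigr => k _.
have hu' := weightFk k hu; have hv' := weightEk k hv.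
rewrite /DeltaopK !linearZ /= (R0w _ _ _ _ hu' hv').
rewrite [in RHS]linearZ /= tens_lfunE hu' hv' tensZ !scalerA; congr (_ *: _).
rewrite -!mulrA -!expfzDr //; congr (_ * q ^ _); rewrite !ipDr !ipNr; ring.
Qed.

End RmatrixFacts.

Lemma qvar_neq0 (R : realType) : qvar R != 0.
Proof. by rewrite tofrac_eq0 polyX_eq0. Qed.

Lemma qvar_inf (R : realType) (m : int) : qvar R ^ m = 1 -> m = 0.
Proof.
have h n : qvar R ^+ n = 1 -> n = 0%N.
  rewrite -tofracXn -tofrac1 => /eqP; rewrite tofrac_eq => /eqP /(congr1 (size \o polyseq)).
  by rewrite /= size_polyXn size_poly1 => -[].
case: m => n; first by rewrite -exprnP => /h ->.
rewrite NegzE -exprnN => /(congr1 GRing.inv); rewrite invrK invr1 => /h //.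
Qed.

Lemma universal_R_exists (R : realType) : exists c, universal_R (qvar R) c.
Proof.
by exists (Rcoef (qvar R)); apply: Rcoef_universal; [exact: qvar_neq0|exact: qvar_inf].
Qed.

(* Main.v *)
From HB Require Import structures.
Require Import Defs.
From mathcomp Require Import all_boot all_order all_algebra.
From mathcomp Require Import fraction generic_quotient complex boolp classical_sets reals.
From mathcomp Require Import ring zify.

Set Implicit Arguments.
Unset Strict Implicit.
Unset Printing Implicit Defensive.

Import Order.TTheory GRing.Theory Num.Theory.
Local Open Scope ring_scope.

(** Let v_0, .., v_l be the basis of V_l with E v_a = [a] v_(a-1) and
    F v_a = [l-a] v_(a+1), and let the depth of v_(a_1) (x) .. (x) v_(a_n) be
    a_1 + .. + a_n.

    The braiding commutes with the coproduct and is triangular, so it acts on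
    the highest weight vector h_n of depth n in V_l (x) V_l by (-1)^n times a
    power of q; hence in depth k <= l the exterior square is spanned by the
    F^(k-n) h_n with n odd.  As q -> 0 the coefficient of v_(k-b) (x) v_b in
    F^(k-n) h_n, normalised to 1 + O(q) at b = n, is O(q^(|b-n|(1+l-k))), and
    at b = n-1 it is -q^(1+l-k)(1 + O(q)).

    For t in the third power, t_abc with b or c even is then q-adically small
    compared with the coefficients with b and c odd.  When b and c are both
    even, the bound obtained from slots 1, 2 is sharper than the leading term
    obtained from slots 2, 3, which forces the coefficients with b and c odd to
    be smaller than assumed.  By descent t vanishes in depth <= l, and by the
    symmetry v_a (x) v_b -> v_(l-b) (x) v_(l-a), E <-> F, in depth >= 2l.

    Let t be in the fourth power, with v_0-coefficient z in the first slot.  In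
    z the two first slots have depth > l because the first three slots of t do;
    applying F until the last slot is v_l would produce depth > 2l in the third
    power, so z = 0.  Stability under E propagates this to all v_a. *)

(** * Expansions at q = 0 *)

(* [O] plays the role of the local ring of K at q = 0. *)
Record qadic (K : fieldType) (q : K) (O : K -> Prop) : Prop := Qadic {
  qadic_neq0 : q != 0;
  qadic1 : O 1;
  qadicB : forall x y, O x -> O y -> O (x - y);
  qadicM : forall x y, O x -> O y -> O (x * y);
  qadicq : O q;
  qadicV : forall x, O x -> 1 + q * x != 0 /\ O (1 + q * x)^-1;
  qadic_arch : forall x, exists N : nat, O (q ^ (N%:Z) * x);
  qadic_sep : forall x, (forall N : nat, O (q ^ (- N%:Z) * x)) -> x = 0
}.

Section Qadic.
Variables (K : fieldType) (q : K) (O : K -> Prop).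
Hypothesis hO : qadic q O.

Let q0 : q != 0 := qadic_neq0 hO.
Let O1 := qadic1 hO.
Let Oq := qadicq hO.
Let OB := qadicB hO.
Let OM := qadicM hO.

(** Membership in the fractional ideal q^n O, that is, valuation at least n; n may be negative. *)
Definition qO (n : int) (x : K) : Prop := O (q ^ (- n) * x).

Lemma qadic0 : O 0.
Proof. by rewrite -(subrr 1); apply: OB; apply: O1. Qed.

Lemma qadicN x : O x -> O (- x).
Proof. by move=> h; rewrite -sub0r; apply: OB => //; apply: qadic0. Qed.

Lemma qadicXn (n : nat) : O (q ^ (n%:Z)).
Proof.
elim: n => [|n IH]; first by rewrite expr0z; apply: O1.
by rewrite -exprnP exprS; apply: OM => //; apply: Oq.
Qed.

Lemma qO0 n : qO n 0. Proof. by rewrite /qO mulr0; apply: qadic0. Qed.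

Lemma qOB n x y : qO n x -> qO n y -> qO n (x - y).
Proof. by rewrite /qO mulrBr; apply: OB. Qed.

Lemma qON n x : qO n x -> qO n (- x).
Proof. by rewrite /qO mulrN; apply: qadicN. Qed.

Lemma qOD n x y : qO n x -> qO n y -> qO n (x + y).
Proof. by move=> hx hy; rewrite -(opprK y); apply: qOB => //; apply: qON. Qed.

Lemma qOM m n x y : qO m x -> qO n y -> qO (m + n) (x * y).
Proof. by rewrite /qO opprD expfzDr // mulrACA; apply: OM. Qed.

Lemma qOW n m x : (m <= n)%R -> qO n x -> qO m x.
Proof.
move=> mn h; rewrite /qO.
have -> : - m = (`|n - m|)%N%:Z + - n by lia.
by rewrite expfzDr // -mulrA; apply: OM => //; apply: qadicXn.
Qed.

Lemma qO_sum (I : Type) (r : seq I) (P : pred I) (f : I -> K) n :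
  (forall i, P i -> qO n (f i)) -> qO n (\sum_(i <- r | P i) f i).
Proof.
by move=> h; apply: (big_ind (qO n)) => //; [exact: qO0|move=> x y; exact: qOD].
Qed.

Lemma qO_pow n : qO n (q ^ n).
Proof. by rewrite /qO -expfzDr // addNr expr0z; apply: O1. Qed.

Lemma qO_eq0 x : (forall n : int, qO n x) -> x = 0.
Proof. by move=> h; apply: (qadic_sep hO) => N; apply: h. Qed.

(** Supplies the initial bound from which the successive approximations below start. *)
Lemma qO_bounded m (f : nat -> K) : exists n : int, forall i, (i < m)%N -> qO n (f i).
Proof.
elim: m => [|m [n IH]]; first by exists 0.
have [N hN] := qadic_arch hO (f m).
exists (Order.min n (- N%:Z)) => i; rewrite ltnS leq_eqVlt => /orP[/eqP->|/IH h].
  by apply: (@qOW (- N%:Z)); [rewrite ge_min lexx orbT|rewrite /qO opprK].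
by apply: qOW h; rewrite ge_min lexx.
Qed.

(* [qlead n s x] says that the q-adic expansion of x starts with s q^n. *)
Definition qlead (n : int) (s x : K) : Prop := qO (n + 1) (x - s * q ^ n).

Lemma qO_lead n s x : O s -> qlead n s x -> qO n x.
Proof.
move=> hs h; rewrite -(subrK (s * q ^ n) x); apply: qOD.
  by apply: qOW h; lia.
rewrite -[n]add0r; apply: qOM; last by rewrite add0r; apply: qO_pow.
by rewrite /qO oppr0 expr0z mul1r.
Qed.

Lemma qleadM m n s s' x y : O s -> O s' -> qlead m s x -> qlead n s' y ->
  qlead (m + n) (s * s') (x * y).
Proof.
move=> hs hs' hx hy; rewrite /qlead.
have -> : x * y - s * s' * q ^ (m + n) =
    (x - s * q ^ m) * y + s * (q ^ m * (y - s' * q ^ n)) by rewrite expfzDr //; ring.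
apply: qOD.
  by apply: (@qOW (m + 1 + n)); [lia|apply: qOM => //; apply: qO_lead hy].
rewrite -[m + n + 1]add0r; apply: qOM; first by rewrite /qO oppr0 expr0z mul1r.
by rewrite -addrA; apply: qOM => //; apply: qO_pow.
Qed.

Lemma qleadM1 m n s x y : O s -> qlead m 1 x -> qlead n s y -> qlead (m + n) s (x * y).
Proof. by move=> hs hx hy; rewrite -[s]mul1r; apply: qleadM. Qed.

Lemma qleadD n s x y : qlead n s x -> qO (n + 1) y -> qlead n s (x + y).
Proof. by move=> hx hy; rewrite /qlead addrAC; apply: qOD. Qed.

Lemma qlead_pow n : qlead n 1 (q ^ n).
Proof. by rewrite /qlead mul1r subrr; apply: qO0. Qed.

Lemma qleadN n s x : qlead n s x -> qlead n (- s) (- x).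
Proof. by rewrite /qlead mulNr -opprD; apply: qON. Qed.

(** Factor x as s q^n (1 + q y) with y in O: the last factor is a unit of O, and s is its own
    inverse. *)
Lemma qlead_unit n s x : s * s = 1 -> O s -> qlead n s x ->
  x != 0 /\ qO (- n) x^-1.
Proof.
move=> ss hs h.
pose y := s * (q ^ (- (n + 1)) * (x - s * q ^ n)).
have Oy : O y by apply: OM.
have xE : x = s * q ^ n * (1 + q * y).
  rewrite /y; transitivity ((s * s) * (q ^ n * q ^ 1 * q ^ (- (n + 1))) * x
     + s * (1 - s * s * (q ^ n * q ^ 1 * q ^ (- (n + 1)))) * q ^ n); last first.
    by rewrite expr1z; ring.
  by rewrite -!expfzDr // subrr expr0z ss; ring.
have [ny Oy'] := qadicV hO Oy.
have s0 : s != 0 by apply/eqP => s0; move/eqP: ss; rewrite s0 mulr0 eq_sym oner_eq0.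
have sV : s^-1 = s by apply: (mulfI s0); rewrite divff.
have qn : q ^ n != 0 by rewrite expfz_neq0.
split; first by rewrite xE !mulf_neq0.
rewrite /qO opprK xE !invfM sV.
have -> : q ^ n * (s * (q ^ n)^-1 * (1 + q * y)^-1) = s * (1 + q * y)^-1 by field; rewrite qn ny.
exact: OM.
Qed.

Lemma qlead_cancel m n s x y : s * s = 1 -> O s -> qlead n s x ->
  qO (n + m) (x * y) -> qO m y.
Proof.
move=> ss hs hx h; have [x0 xV] := qlead_unit ss hs hx.
have -> : m = - n + (n + m) by lia.
by rewrite -(mulKf x0 y); apply: qOM.
Qed.

Lemma qleadV n x : qlead n 1 x -> qlead (- n) 1 x^-1.
Proof.
move=> hx; have [x0 xV] := qlead_unit (mulr1 1) O1 hx.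
rewrite /qlead mul1r.
have qn : q ^ n != 0 by rewrite expfz_neq0.
have -> : x^-1 - q ^ (- n) = x^-1 * (- q ^ (- n) * (x - 1 * q ^ n)).
  by rewrite mul1r -invr_expz; field; rewrite qn x0.
rewrite mulNr mulrN; apply: qON.
have -> : - n + 1 = - n + (- n + (n + 1)) by lia.
by apply: qOM => //; apply: qOM => //; apply: qO_pow.
Qed.

Lemma qqV_neq0 : q - q^-1 != 0.
Proof.
apply/eqP => e; have [+ _] := qadicV hO (qadicN Oq).
have : q * (q - q^-1) = 0 by rewrite e mulr0.
by rewrite mulrBr mulfV // mulrN => /subr0_eq ->; rewrite subrr eqxx.
Qed.

Lemma qbr_lead (m : nat) : (0 < m)%N -> qlead (1 - m%:Z) 1 (qbr q m%:Z).
Proof.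
move=> m0.
(* Numerator and denominator both have leading coefficient -1; they are negated below because
   [qleadV] treats only the leading coefficient 1. *)
have hD : qlead (-1) (-1) (q - q^-1).
  rewrite /qlead addNr -(expr1z q) invr_expz.
  have -> : q ^ 1 - q ^ (-1) - -1 * q ^ (-1) = q ^ 1 by ring.
  by apply: (@qOW 1) => //; apply: qO_pow.
have hN : qlead (- m%:Z) (-1) (q ^ m%:Z - q ^ (- m%:Z)).
  rewrite /qlead.
  have -> : q ^ m%:Z - q ^ (- m%:Z) - -1 * q ^ (- m%:Z) = q ^ m%:Z by ring.
  by apply: (@qOW m); [lia|apply: qO_pow].
have hDV : qlead 1 1 (- (q - q^-1))^-1.
  by have := qleadN hD; rewrite opprK => /qleadV.
have := qleadN hN; rewrite opprK => /(qleadM O1 O1) /(_ hDV); rewrite mulr1.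
have -> : 1 - m%:Z = - m%:Z + 1 by lia.
by rewrite /qbr mulNr invrN mulrN opprK.
Qed.

Lemma qbr_neq0 (m : nat) : (0 < m)%N -> qbr q m%:Z != 0.
Proof.
by move=> /qbr_lead h; have [] := qlead_unit (mulr1 1) O1 h.
Qed.

End Qadic.

(** * Highest weight vectors of V_l (x) V_l *)

Section SingularCoefficients.
Variables (K : fieldType) (q : K) (l : nat).

(* [hco n i] is the coefficient of v_i (x) v_(n-i) in the highest weight vector
   of depth n of V_l (x) V_l, where E v_a = [a] v_(a-1), F v_a = [l-a] v_(a+1). *)
Fixpoint hco (n i : nat) : K :=
  if i is j.+1 then
    - (q ^ (l%:Z - j%:Z *+ 2) * (qbr q (n%:Z - j%:Z) / qbr q j.+1%:Z)) * hco n j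
  else 1.

(* [gco n r b] is the coefficient of v_(n+r-b) (x) v_b in F^r applied to that
   vector. *)
Fixpoint gco (n r b : nat) : K :=
  if r is s.+1 then
    qbr q (l%:Z - (n + s)%:Z + b%:Z) * q ^ (b%:Z *+ 2 - l%:Z) * gco n s b +
    (if b is b'.+1 then qbr q (l%:Z - b'%:Z) * gco n s b' else 0)
  else if (b <= n)%N then hco n (n - b) else 0.

(** The order of the diagonal coefficient [gco n r n]: step s contributes the order of [l-s]
    q^(2n-l), the factor of the first summand of [gco] at b = n. *)
Fixpoint gexp (n r : nat) : int :=
  if r is s.+1 then gexp n s + (1 - l%:Z *+ 2 + n%:Z *+ 2 + s%:Z) else 0.

Lemma qbrz0 : qbr q 0 = 0.
Proof. by rewrite /qbr oppr0 subrr mul0r. Qed.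

Lemma hco_eq0 n i : (n < i)%N -> hco n i = 0.
Proof.
elim: i => // i IH; rewrite ltnS leq_eqVlt => /orP[/eqP->|/IH /= ->].
  by rewrite /= subrr qbrz0 mul0r mulr0 oppr0 mul0r.
by rewrite mulr0.
Qed.

Lemma gco_eq0 n r b : (n + r < b)%N -> gco n r b = 0.
Proof.
elim: r b => [|r IH] b /=; first by rewrite addn0 ltnNge => /negbTE ->.
case: b => // b; rewrite addnS ltnS => h.
by rewrite (IH b.+1 (ltnW h)) (IH b h) !mulr0 addr0.
Qed.

Variable O : K -> Prop.
Hypothesis hO : qadic q O.
Notation vO := (qO q O).
Notation vlead := (qlead q O).
Let O1 := qadic1 hO.

Lemma qbr_leadz (m : int) (n : int) : (0 < m)%R -> n = 1 - m -> vlead n 1 (qbr q m).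
Proof. by case: m => [m|//] m0 ->; apply: (qbr_lead hO); rewrite -ltz_nat. Qed.

Lemma qO_lead1 n x : vlead n 1 x -> vO n x.
Proof. exact: (qO_lead hO). Qed.

(** One step of the recursion multiplies by a factor of order (l - 2i) + (1 - (n - i)) + i = 1 + l -
    n. *)
Lemma hco_qO n i : (n <= l)%N -> vO (i%:Z * (1 + l%:Z - n%:Z)) (hco n i).
Proof.
move=> nl; elim: i => [|i IH] /=; first by rewrite mul0r /qO oppr0 expr0z mul1r.
case: (leqP n i) => ni.
  have [->|lt] := eqVneq n i.
    by rewrite subrr qbrz0 mul0r mulr0 oppr0 mul0r; apply: (qO0 hO).
  by rewrite (hco_eq0 (_ : n < i)%N) ?mulr0; [apply: (qO0 hO)|lia].
rewrite mulNr; apply: (qON hO).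
have := qO_lead1 (qleadV hO (@qbr_leadz i.+1 _ isT erefl)).
have := qO_lead1 (@qbr_leadz (n%:Z - i%:Z) _ ltac:(lia) erefl).
have := qO_pow hO (l%:Z - i%:Z *+ 2) => h1 h2 h3.
have := qOM hO (qOM hO h1 (qOM hO h2 h3)) IH.
by apply: (qOW hO); lia.
Qed.

Lemma gco_estimates n r : (n + r <= l)%N ->
  [/\ vlead (gexp n r) 1 (gco n r n),
      forall d, (d <= n)%N ->
        vO (gexp n r + d%:Z * (1 + l%:Z - (n + r)%:Z)) (gco n r (n - d)),
      forall d, vO (gexp n r + d%:Z * (1 + l%:Z - (n + r)%:Z)) (gco n r (n + d))
    & (0 < n)%N ->
        vlead (gexp n r + (1 + l%:Z - (n + r)%:Z)) (-1) (gco n r n.-1)].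
Proof.
elim: r => [|r IH] nr.
  rewrite /= leqnn subnn /= addn0 add0r; split.
  - exact: (qlead_pow hO).
  - move=> d dn; rewrite leq_subr subKn // add0r; apply: hco_qO; lia.
  - case=> [|d]; last by rewrite ifF; [apply: (qO0 hO)|lia].
    by rewrite addn0 leqnn subnn mul0r add0r /qO oppr0 expr0z mul1r.
  - case: n nr => // n nr _ /=.
    rewrite leqnSn subSnn /= mulr1.
    have := qleadM1 hO O1 (qlead_pow hO l%:Z)
      (qleadM1 hO O1 (@qbr_leadz n.+1%:Z _ isT erefl) (qleadV hO (@qbr_leadz 1%:Z _ isT erefl))).
    move=> /(qleadN hO).
    have -> : l%:Z + (1 - n.+1%:Z + - (1 - 1%:Z)) = 1 + l%:Z - n.+1%:Z by lia.
    by rewrite mul0rn !subr0.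
have [h1 h2 h3 h4] := IH (ltac:(lia)).
have c1 (b : nat) : vlead (1 - l%:Z *+ 2 + (n + r + b)%:Z) 1
    (qbr q (l%:Z - (n + r)%:Z + b%:Z) * q ^ (b%:Z *+ 2 - l%:Z)).
  have := qleadM1 hO O1 (@qbr_leadz (l%:Z - (n + r)%:Z + b%:Z) _ ltac:(lia) erefl)
     (qlead_pow hO (b%:Z *+ 2 - l%:Z)).
  by congr (qlead _ _ _ _); lia.
have c2 (b : nat) : (b < l)%N -> vlead (1 - l%:Z + b%:Z) 1 (qbr q (l%:Z - b%:Z)).
  by move=> bl; apply: qbr_leadz; lia.
split=> /=.
- apply: (qleadD hO).
    have := qleadM1 hO O1 (c1 n) h1; congr (qlead _ _ _ _); lia.
  case: n h2 {h1 h3 h4} IH nr c1 => [|n] h2 IH nr c1; first exact: (qO0 hO).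
  have := qOM hO (qO_lead1 (c2 n (ltac:(lia)))) (h2 1%N isT).
  by rewrite subn1 /=; apply: (qOW hO); lia.
- move=> d dn; apply: (qOD hO).
    have := qOM hO (qO_lead1 (c1 (n - d)%N)) (h2 d dn).
    by apply: (qOW hO); lia.
  case E : (n - d)%N => [|b]; first exact: (qO0 hO).
  have := qOM hO (qO_lead1 (c2 b (ltac:(lia)))) (h2 d.+1 (ltac:(lia))).
  have -> : (n - d.+1 = b)%N by lia.
  apply: (qOW hO); lia.
- move=> d; apply: (qOD hO).
    have := qOM hO (qO_lead1 (c1 (n + d)%N)) (h3 d).
    by apply: (qOW hO); lia.
  case: d => [|d].
    rewrite addn0; case: n h2 {h1 h3 h4} IH nr c1 => [|n] h2 IH nr c1; first exact: (qO0 hO).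
    have := qOM hO (qO_lead1 (c2 n (ltac:(lia)))) (h2 1%N isT).
    by rewrite subn1 /=; apply: (qOW hO); lia.
  rewrite [(n + d.+1)%N]addnS; case: (ltnP (n + r) (n + d)) => lt.
    by rewrite (gco_eq0 lt) mulr0; apply: (qO0 hO).
  have := qOM hO (qO_lead1 (c2 (n + d)%N (ltac:(lia)))) (h3 d).
  apply: (qOW hO); lia.
- move=> n0; apply: (qleadD hO).
    have := qleadM1 hO (qadicN hO O1) (c1 n.-1) (h4 n0).
    congr (qlead _ _ _ _); lia.
  case E : n.-1 => [|b]; first exact: (qO0 hO).
  have := qOM hO (qO_lead1 (c2 b (ltac:(lia)))) (h2 2 (ltac:(lia))).
  have -> : (n - 2 = b)%N by lia.
  apply: (qOW hO); lia.
Qed.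

(** F^(k-n) of the highest weight vector of depth n, rescaled so that for k <= l the matrix indexed
    by n and b is the identity modulo q. *)
Definition gvec (k n b : nat) : K := q ^ (- gexp n (k - n)) * gco n (k - n) b.

Lemma gvec_diag k n : (n <= k <= l)%N -> vO 1 (gvec k n n - 1).
Proof.
move=> /andP[nk kl]; have [h _ _ _] := @gco_estimates n (k - n) (ltac:(lia)).
have := qleadM1 hO O1 (qlead_pow hO (- gexp n (k - n))) h.
by rewrite addNr /qlead expr0z mul1r add0r.
Qed.

Lemma gvec_qO k n b : (n <= k <= l)%N ->
  vO ((`|n%:Z - b%:Z|%N)%:Z * (1 + l%:Z - k%:Z)) (gvec k n b).
Proof.
move=> /andP[nk kl]; have [_ h2 h3 _] := @gco_estimates n (k - n) (ltac:(lia)).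
have hq := qO_pow hO (- gexp n (k - n)).
case: (leqP b n) => bn.
  have := qOM hO hq (h2 (n - b)%N (leq_subr _ _)); rewrite subKn // (subnKC nk) addKr.
  congr (qO _ _ _); congr (_ * _); lia.
have := qOM hO hq (h3 (b - n)%N); rewrite (subnKC (ltnW bn)) (subnKC nk) addKr.
congr (qO _ _ _); congr (_ * _); lia.
Qed.

Lemma gvec_lead k n : (n < k <= l)%N -> vlead (1 + l%:Z - k%:Z) (-1) (gvec k n.+1 n).
Proof.
move=> /andP[nk kl]; have [_ _ _ /(_ isT) h] := @gco_estimates n.+1 (k - n.+1) (ltac:(lia)).
have := qleadM1 hO (qadicN hO O1) (qlead_pow hO (- gexp n.+1 (k - n.+1))) h.
by rewrite addKr subnKC.
Qed.

End SingularCoefficients.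

(** * Vanishing of the third power in low depth *)

Definition dist (m n : nat) : int := (`|m%:Z - n%:Z|%N)%:Z.

(** The form that the hypothesis [om_lip] below takes for the weight [om] constantly 0. *)
Lemma dist_flat (n b : nat) (u : int) : 0 <= u -> n != b -> 0 + u <= 0 + dist n b * u.
Proof.
move=> u0 nb; rewrite /dist; have : 1 <= (`|n%:Z - b%:Z|%N)%:Z by lia.
by move: (`|_|%N)%:Z => d d1; nia.
Qed.

Section LowDepth.
Variables (K : fieldType) (q : K) (l : nat) (O : K -> Prop).
Hypothesis hO : qadic q O.
Notation vO := (qO q O).
Notation vlead := (qlead q O).
Notation g := (gvec q l).

Definition gspan (P : pred nat) (k : nat) (y w : nat -> K) : Prop :=
  forall b, (b <= k)%N -> w b = \sum_(n < k.+1 | P n) y n * g k n b.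

(** * Estimates for a single slice, by successive approximation *)

Section Slice.
Variables (P : pred nat) (k : nat) (y w : nat -> K) (N e : int) (om : nat -> int).
Hypotheses (kl : (k <= l)%N) (yw : gspan P k y w) (e1 : 1 <= e).
Hypothesis om_lip : forall n b, n != b -> om b + e <= om n + dist n b * (1 + l%:Z - k%:Z).
Hypothesis w_in : forall b, (b <= k)%N -> P b -> vO (N + om b) (w b).

(** Since [g] is the identity modulo q, solving the b-th equation for y_b leaves w_b and terms whose
    order exceeds the current bound by at least 1; [om_lip] controls the off-diagonal ones. *)
Lemma slice_coef_step M : (forall n, (n <= k)%N -> P n -> vO (M + om n) (y n)) ->
  forall n, (n <= k)%N -> P n -> vO (Order.min N (M + 1) + om n) (y n).
Proof.
move=> hy b bk Pb.
have hb : (b < k.+1)%N by [].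
have := yw bk; rewrite (bigD1 (Ordinal hb)) //= => e0.
have -> : y b = w b - (y b * (g k b b - 1) +
    \sum_(i < k.+1 | P i && (i != Ordinal hb)) y i * g k i b).
  by rewrite e0; ring.
apply: (qOB hO); first by apply: (qOW hO _ (w_in bk Pb)); rewrite lerD2r ge_min lexx.
have mle : Order.min N (M + 1) <= M + 1 by rewrite ge_min lexx orbT.
apply: (qOD hO).
  have := qOM hO (hy _ bk Pb) (@gvec_diag _ _ l _ hO k b (ltac:(lia))).
  by apply: (qOW hO); lia.
apply: (qO_sum hO) => -[n hn] /= /andP[Pn nb].
have nb' : n != b by apply: contra nb => /eqP nb; apply/eqP/val_inj.
have := qOM hO (hy _ hn Pn) (@gvec_qO _ _ l _ hO k n b (ltac:(lia))).
have := om_lip nb'; rewrite /dist => ob'.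
by apply: (qOW hO); move: (_ * (1 + _ - _)) ob' => ? ?; lia.
Qed.

Lemma slice_coef n : (n <= k)%N -> P n -> vO (N + om n) (y n).
Proof.
(* The factor q^(- om n) turns the uniform bound M into the weighted bound M + om n. *)
have [M hM] := qO_bounded hO k.+1 (fun n => q ^ (- om n) * y n).
have hy m : (m <= k)%N -> P m -> vO (M + om m) (y m).
  move=> mk _; have := qOM hO (qO_pow hO (om m)) (hM m mk).
  by rewrite mulrA -expfzDr ?(qadic_neq0 hO) // subrr expr0z mul1r addrC.
have step (j : nat) m : (m <= k)%N -> P m -> vO (Order.min N (M + j%:Z) + om m) (y m).
  elim: j m => [|j IH] m mk Pm.
    by apply: (qOW hO _ (hy m mk Pm)); rewrite addr0 lerD2r ge_min lexx orbT.
  have := @slice_coef_step _ IH m mk Pm; apply: (qOW hO).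
  by rewrite lerD2r le_min ge_min lexx /=; have := ge_min; lia.
move=> nk Pn; apply: (qOW hO _ (step `|N - M|%N n nk Pn)).
by rewrite lerD2r le_min lexx /=; lia.
Qed.

(** Outside P the diagonal term is absent, and every other term gains at least e by [om_lip]. *)
Lemma slice_out b : (b <= k)%N -> ~~ P b -> vO (N + om b + e) (w b).
Proof.
move=> bk nPb; rewrite (yw bk); apply: (qO_sum hO) => -[n hn] /= Pn.
have nb : n != b by apply: contra nPb => /eqP <-.
have := qOM hO (slice_coef hn Pn) (@gvec_qO _ _ l _ hO k n b (ltac:(lia))).
have := om_lip nb; rewrite /dist => ob'.
by apply: (qOW hO); move: (_ * (1 + _ - _)) ob' => ? ?; lia.
Qed.

End Slice.

(* In depth k <= l, f lies in the span of the F^(k-n) h_n with n odd. *)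
Definition lowspan (f : nat -> nat -> K) : Prop :=
  forall k, (k <= l)%N -> exists y, gspan odd k y (fun b => f (k - b)%N b).

(** * The descent in the third power *)

Section Triple.
Variable t : nat -> nat -> nat -> K.
Hypothesis t23 : forall a, lowspan (t a).
Hypothesis t12 : forall c, lowspan (fun a b => t a b c).
Variable k : nat.
Hypothesis kl : (k <= l)%N.
Let eps : int := 1 + l%:Z - k%:Z.

(* The weight -a makes the q-adic bounds of the successive slices match. *)
Definition oo_bound (N : int) : Prop := forall a b c, (a + b + c = k)%N ->
  odd b -> odd c -> vO (N - a%:Z) (t a b c).

(** With c fixed, the weight -a equals b - (k - c), so [om] is the identity. Its slope lowers the
    gain from 1 + l - (k - c) to l - (k - c), which is still at least [eps] because c, being odd, is
    positive. *)
Lemma eo_bound N a b c : oo_bound N -> (a + b + c = k)%N -> ~~ odd b -> odd c ->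
  vO (N - a%:Z + eps) (t a b c).
Proof.
move=> H abc nob oc.
have [y hy] := t12 c (leq_trans (leq_subr c k) kl).
have c0 : (0 < c)%N by case: (c) oc.
have /= := @slice_out odd _ y _ (N - (k - c)%N%:Z) (l%:Z - (k - c)%N%:Z) (fun b => b%:Z)
   (leq_trans (leq_subr c k) kl) hy (ltac:(lia)) _ _ b (ltac:(lia)) nob.
have -> : (k - c - b = a)%N by lia.
move=> h; apply: (qOW hO _ (h _ _)).
- by rewrite /eps; lia.
- move=> n b' nb; rewrite /dist.
  have : 1 <= (`|n%:Z - b'%:Z|%N)%:Z by lia.
  have : b'%:Z - n%:Z <= (`|n%:Z - b'%:Z|%N)%:Z by lia.
  move: (`|_|%N)%:Z => d d1 d2; have : (1 <= l%:Z - (k - c)%N%:Z) by lia.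
  rewrite -[1 + l%:Z - _]addrA; move: (l%:Z - (k - c)%N%:Z) => u u1.
  have : 1 * u <= d * u by rewrite ler_wpM2r //; lia.
  by rewrite mulrDr mulr1; move: (d * u) => z; lia.
- move=> b' b'k ob'; have := H (k - c - b')%N b' c (ltac:(lia)) ob' oc.
  by apply: (qOW hO); lia.
Qed.

(** With a fixed, k - a is odd, so an odd last index comes with an even middle index and [eo_bound]
    applies. The gain 1 + l - (k - a) = eps + a cancels the weight -a. *)
Lemma oe_bound N a b c : oo_bound N -> (a + b + c = k)%N -> odd b -> ~~ odd c ->
  vO (N + eps *+ 2) (t a b c).
Proof.
move=> H abc ob noc.
have kal := leq_trans (leq_subr a k) kl.
have [y hy] := t23 a kal.
have /= := @slice_out odd _ y _ (N - a%:Z + eps) (1 + l%:Z - (k - a)%N%:Z) (fun=> 0)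
   kal hy (ltac:(lia)) _ _ c (ltac:(lia)) noc.
have -> : (k - a - c = b)%N by lia.
move=> h; apply: (qOW hO _ (h _ _)).
- by rewrite /eps; lia.
- by move=> n b' nb; apply: dist_flat => //; lia.
- move=> c' c'k oc'; rewrite addr0; apply: (eo_bound H) => //; lia.
Qed.

(** With c fixed, [oe_bound] is the input and the gain is at least [eps]; of the resulting order N +
    3 eps only N + eps + 1 is kept. *)
Lemma ee_bound N a b c : oo_bound N -> (a + b + c = k)%N -> ~~ odd b -> ~~ odd c ->
  vO (N + eps + 1) (t a b c).
Proof.
move=> H abc nob noc.
have kcl := leq_trans (leq_subr c k) kl.
have [y hy] := t12 c kcl.
have /= := @slice_out odd _ y _ (N + eps *+ 2) (1 + l%:Z - (k - c)%N%:Z) (fun=> 0)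
   kcl hy (ltac:(lia)) _ _ b (ltac:(lia)) nob.
have -> : (k - c - b = a)%N by lia.
move=> h; apply: (qOW hO _ (h _ _)).
- by rewrite /eps; lia.
- by move=> n b' nb; apply: dist_flat => //; lia.
- move=> b' b'k ob'; rewrite addr0; apply: (oe_bound H) => //; lia.
Qed.

(** In the slice of slots 2, 3, the coefficient at c = m even contains y_(m+1) with a factor
    starting with -q^u, u = eps + a. Its middle index is even too, as k - a is even, so [ee_bound]
    gives it order N + eps + 1; hence y_(m+1) has order N + 1 - a, one more than before. *)
Lemma oo_boundS N : oo_bound N -> oo_bound (N + 1).
Proof.
move=> H a b c abc ob oc.
have kal := leq_trans (leq_subr a k) kl.
have [y hy] := t23 a kal.
set u := 1 + l%:Z - (k - a)%N%:Z.
have u1 : 1 <= u by lia.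
have hyN n : (n <= k - a)%N -> odd n -> vO (N - a%:Z) (y n).
  move=> nk on.
  have := @slice_coef odd _ y _ (N - a%:Z) u (fun=> 0) kal hy u1 _ _ n nk on.
  rewrite addr0; apply.
    by move=> n' b' nb; apply: dist_flat => //; lia.
  by move=> c' c'k oc'; apply: H => //; lia.
(* With n = m + 1, the terms of index below m are small by induction, those of index above m + 1 by
   their factor of order at least 2u. *)
have hyS n : (n <= k - a)%N -> odd n -> vO (N + 1 - a%:Z) (y n).
  elim/ltn_ind: n => -[//|m] IH mk om.
  have := @ee_bound N a (k - a - m) m H (ltac:(lia)) (ltac:(lia)) (ltac:(lia)).
  rewrite (hy m (ltac:(lia))) (bigD1 (Ordinal (mk : m.+1 < (k - a).+1)%N)) //=.
  set S : K := bigop _ _ _ => hS.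
  have qS : vO (N + eps + 1) S.
    apply: (qO_sum hO) => -[n hn] /= /andP[on nm].
    have nm' : n != m.+1 by apply: contra nm => /eqP nm; apply/eqP/val_inj.
    have hg := @gvec_qO _ _ l _ hO (k - a) n m (ltac:(lia)).
    case: (ltnP n m) => nltm.
      have := qOM hO (IH n (ltac:(lia)) hn on) hg.
      have := @dist_flat n m u (ltac:(lia)) (ltac:(lia)); rewrite /dist /eps -/u.
      by move: (_ * u) => z ?; apply: (qOW hO); lia.
    have nm3 : 2 <= (`|n%:Z - m%:Z|%N)%:Z by lia.
    have := qOM hO (hyN n hn on) hg; rewrite -/u.
    move: (`|_|%N)%:Z nm3 => d d3; apply: (qOW hO).
    have : 2 * u <= d * u by nia.
    by rewrite /eps; move: (d * u); lia.
  have : vO (u + (N + 1 - a%:Z)) (g (k - a) m.+1 m * y m.+1).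
    have := qOB hO hS qS; rewrite addrK mulrC.
    by apply: (qOW hO); rewrite /eps /u; lia.
  apply: (qlead_cancel hO _ _ (@gvec_lead _ _ l _ hO (k - a) m (ltac:(lia)))).
    by rewrite mulrNN mulr1.
  exact: (qadicN hO (qadic1 hO)).
have -> : t a b c = t a (k - a - c)%N c by congr (t a _ c); lia.
rewrite (hy c (ltac:(lia))); apply: (qO_sum hO) => -[n hn] /= on.
have := qOM hO (hyS n hn on) (@gvec_qO _ _ l _ hO (k - a) n c (ltac:(lia))).
rewrite -/u; apply: (qOW hO).
have : 0 <= (`|n%:Z - c%:Z|%N)%:Z * u by apply: mulr_ge0; lia.
by move: (_ * u) => z; lia.
Qed.

Lemma oo_bound_all N : oo_bound N.
Proof.
(* The pair (b, c) is coded as b (k + 1) + c; the depth k determines a. *)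
have [M hM] := qO_bounded hO (k.+1 * k.+1) (fun i =>
  t (k - i %/ k.+1 - i %% k.+1) (i %/ k.+1) (i %% k.+1)).
have H0 : oo_bound M.
  move=> a b c abc _ _; have ck : (c < k.+1)%N by lia.
  have := hM (b * k.+1 + c)%N (ltac:(nia)).
  rewrite divnMDl // modnMDl (divn_small ck) (modn_small ck) addn0.
  have -> : (k - b - c = a)%N by lia.
  by apply: (qOW hO); lia.
have HS (j : nat) : oo_bound (M + j%:Z).
  elim: j => [|j IH]; first by rewrite addr0.
  have -> : M + j.+1%:Z = M + j%:Z + 1 by lia.
  exact: oo_boundS.
move=> a b c abc ob oc; apply: (qOW hO _ (HS `|N - M|%N a b c abc ob oc)); lia.
Qed.

Lemma triple_eq0 a b c : (a + b + c = k)%N -> t a b c = 0.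
Proof.
move=> abc; apply: (qO_eq0 hO) => n.
case: (boolP (odd b)) => ob; case: (boolP (odd c)) => oc.
- by apply: (qOW hO _ (@oo_bound_all (n + a%:Z) a b c abc ob oc)); lia.
- by apply: (qOW hO _ (oe_bound (@oo_bound_all n) abc ob oc)); rewrite /eps; lia.
- by apply: (qOW hO _ (eo_bound (@oo_bound_all (n + a%:Z)) abc ob oc)); rewrite /eps; lia.
- by apply: (qOW hO _ (ee_bound (@oo_bound_all n) abc ob oc)); rewrite /eps; lia.
Qed.

End Triple.
End LowDepth.

(** * Eigenvectors of the braiding *)

Section HcoLast.
Variables (K : fieldType) (q : K) (l : nat) (O : K -> Prop).
Hypothesis hO : qadic q O.

Definition qfact (n : nat) : K := \prod_(i < n) qbr q i.+1%:Z.

Lemma qfact_neq0 n : qfact n != 0.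
Proof. by apply/prodf_neq0 => i _; apply: (qbr_neq0 hO). Qed.

Lemma qfactS n : qfact n.+1 = qfact n * qbr q n.+1%:Z.
Proof. by rewrite /qfact big_ord_recr. Qed.

(** Up to sign and a power of q, [hco q l n i] is a Gaussian binomial coefficient. *)
Lemma hco_qfact n i : (i <= n)%N -> exists m : int,
  hco q l n i * (qfact i * qfact (n - i)) = (-1) ^+ i * q ^ m * qfact n.
Proof.
elim: i => [|i IH] ni.
  by exists 0; rewrite expr0z expr0 subn0 /= {1}/qfact big_ord0 !mul1r.
have [m hm] := IH (ltnW ni); exists (l%:Z - i%:Z *+ 2 + m).
rewrite expfzDr ?(qadic_neq0 hO) // exprS.
have -> : -1 * (-1) ^+ i * (q ^ (l%:Z - i%:Z *+ 2) * q ^ m) * qfact n =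
  - q ^ (l%:Z - i%:Z *+ 2) * ((-1) ^+ i * q ^ m * qfact n) by ring.
rewrite -hm /=; have -> : (n - i = (n - i.+1).+1)%N by lia.
rewrite (qfactS i) (qfactS (n - i.+1)).
have -> : n%:Z - i%:Z = (n - i.+1).+1%:Z by lia.
by field; apply: (qbr_neq0 hO).
Qed.

Lemma hco_last n : exists m : int, hco q l n n = (-1) ^+ n * q ^ m.
Proof.
have [m] := hco_qfact (leqnn n); rewrite subnn {2}/qfact big_ord0 mulr1.
by move/(mulIf (qfact_neq0 n)) => h; exists m.
Qed.

(** A linear relation is a slice with w = 0, so [slice_coef] gives y arbitrarily high order. *)
Lemma gvec_free k (y : nat -> K) : (k <= l)%N ->
  (forall b, (b <= k)%N -> \sum_(n < k.+1) y n * gvec q l k n b = 0) ->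
  forall n, (n <= k)%N -> y n = 0.
Proof.
move=> kl h n nk; apply: (qO_eq0 hO) => N; rewrite -[N]addr0.
apply: (slice_coef hO kl (P := xpredT) (w := fun=> 0) (e := 1) (om := fun=> 0)) => //.
- by move=> b bk; rewrite h.
- move=> m b mb; rewrite !add0r.
  have := @dist_flat m b (1 + l%:Z - k%:Z) (ltac:(lia)) mb; rewrite !add0r.
  by apply: le_trans; lia.
- by move=> b _ _; apply: (qO0 hO).
Qed.

Lemma gvec_span k (w : nat -> K) : (k <= l)%N ->
  exists y, gspan q l xpredT k y w.
Proof.
move=> kl; pose G := \matrix_(n < k.+1, b < k.+1) gvec q l k n b.
have rf : row_free G.
  rewrite -kermx_eq0; apply/eqP/row_matrixP => i; rewrite row0.
  have : row i (kermx G) *m G = 0 by rewrite -row_mul mulmx_ker row0.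
  move: (row i _) => z zG; apply/rowP => j; rewrite mxE.
  have := @gvec_free k (fun n => z 0 (inord n)) kl _ j (leq_ord j).
  rewrite inord_val; apply=> b bk.
  have := congr1 (fun A : 'rV_k.+1 => A 0 (Ordinal (bk : (b < k.+1)%N))) zG.
  rewrite mxE [RHS]mxE => h; rewrite -[RHS]h.
  by apply: eq_bigr => n _; rewrite mxE inord_val.
have Gu : G \in unitmx by rewrite -row_free_unit.
pose z := (\row_(b < k.+1) w b) *m invmx G.
exists (fun n => z 0 (inord n)) => b bk.
have := congr1 (fun A : 'rV_k.+1 => A 0 (Ordinal (bk : (b < k.+1)%N)))
  (mulmxKV Gu (\row_(b < k.+1) w b)).
rewrite mxE [RHS]mxE => h; rewrite -[LHS]h.
by apply: eq_bigr => n _; rewrite inord_val [G _ _]mxE.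
Qed.

End HcoLast.

(** [dE] and [dF] are the coproducts of E and F read on the coefficients of v_a (x) v_b. *)
Definition dE (K : fieldType) (q : K) (l : nat) (f : nat -> nat -> K) (a b : nat) : K :=
  qbr q a.+1%:Z * f a.+1 b + q ^ (l%:Z - a%:Z *+ 2) * qbr q b.+1%:Z * f a b.+1.

Definition dF (K : fieldType) (q : K) (l : nat) (f : nat -> nat -> K) (a b : nat) : K :=
  (if a is a'.+1 then qbr q (l%:Z - a'%:Z) * q ^ (b%:Z *+ 2 - l%:Z) * f a' b else 0) +
  (if b is b'.+1 then qbr q (l%:Z - b'%:Z) * f a b' else 0).

(** * Eigenvectors with eigenvalue -q^z, in abstract coordinates that fit both V (x) V and its
    reversal *)

Section OddEigenvectors.
Variables (K : fieldType) (q : K) (l : nat) (O : K -> Prop).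
Hypothesis hO : qadic q O.
Hypothesis q_inf : forall m : int, q ^ m = 1 -> m = 0.
Hypothesis two_neq0 : (1 + 1 : K) != 0.

Variables (T : vectType K) (cf : nat -> nat -> {scalar T}).
Variables DE DF B : 'End(T).

Hypothesis cf_inj : forall s,
  (forall a b, (a <= l)%N -> (b <= l)%N -> cf a b s = 0) -> s = 0.
Hypothesis cf_surj : forall f : nat -> nat -> K, exists s,
  forall a b, (a <= l)%N -> (b <= l)%N -> cf a b s = f a b.
Hypothesis cf_out : forall s a b, (l < a)%N || (l < b)%N -> cf a b s = 0.
Hypothesis cfE : forall s a b, (a <= l)%N -> (b <= l)%N ->
  cf a b (DE s) = dE q l (fun a b => cf a b s) a b.
Hypothesis cfF : forall s a b, (a <= l)%N -> (b <= l)%N ->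
  cf a b (DF s) = dF q l (fun a b => cf a b s) a b.
Hypothesis B_depth : forall s k,
  (forall a b, (a <= l)%N -> (b <= l)%N -> (a + b)%N = k -> cf a b s = 0) ->
  forall a b, (a <= l)%N -> (b <= l)%N -> (a + b)%N = k -> cf a b (B s) = 0.
Hypothesis BE : forall s, B (DE s) = DE (B s).
Hypothesis BF : forall s, B (DF s) = DF (B s).
Hypothesis B_corner : forall n, (n <= l)%N -> exists m : int, forall s,
  cf n 0 (B s) = q ^ m * cf 0 n s.

Lemma cf_eq s s' :
  (forall a b, (a <= l)%N -> (b <= l)%N -> cf a b s = cf a b s') -> s = s'.
Proof.
move=> h; apply/eqP; rewrite -subr_eq0; apply/eqP/cf_inj => a b al bl.
by rewrite linearB /= h ?subrr.
Qed.

Lemma cfZ c s a b : cf a b (c *: s) = c * cf a b s.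
Proof. by rewrite linearZ. Qed.

Definition pure (n : nat) (s : T) : Prop :=
  forall a b, (a <= l)%N -> (b <= l)%N -> (a + b)%N <> n -> cf a b s = 0.

Lemma B_pure n s : pure n s -> pure n (B s).
Proof.
move=> h a b al bl nab; apply: (@B_depth s (a + b)) => // a' b' al' bl' e.
by apply: h => //; rewrite e.
Qed.

(** The equation E s = 0 is the recursion that defines [hco]. *)
Lemma singular_coef n s : (n <= l)%N -> pure n s -> DE s = 0 ->
  forall a, (a <= n)%N -> cf a (n - a) s = hco q l n a * cf 0 n s.
Proof.
move=> nl hp hE; elim=> [|a IH] an; first by rewrite subn0 mul1r.
have := @cfE s a (n - a.+1) (ltac:(lia)) (ltac:(lia)).
rewrite /dE hE linear0 => /esym/eqP; rewrite addr_eq0 => /eqP.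
have -> : ((n - a.+1).+1 = n - a)%N by lia.
rewrite (IH (ltnW an)) => h; apply: (mulfI (qbr_neq0 hO (ltn0Sn a))).
rewrite h /=; have -> : (n - a)%N%:Z = n%:Z - a%:Z by lia.
field; exact: (qbr_neq0 hO).
Qed.

Lemma singular_exists n : (n <= l)%N -> exists h : T,
  [/\ pure n h, DE h = 0 & forall a, (a <= n)%N -> cf a (n - a) h = hco q l n a].
Proof.
move=> nl; have [h hh] := cf_surj (fun a b => if (a + b == n)%N then hco q l n a else 0).
exists h; split.
- by move=> a b al bl /eqP/negbTE ne; rewrite hh // ne.
- apply: cf_inj => a b al bl; rewrite cfE // /dE.
  (* [dE] reads indices up to l + 1, where both sides vanish because n <= l. *)
  have hh' a' b' : (a' <= l.+1)%N -> (b' <= l.+1)%N ->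
      cf a' b' h = if (a' + b' == n)%N then hco q l n a' else 0.
    move=> al' bl'; case: (ltnP l a') => al''.
      by rewrite cf_out ?al'' // ifF //; lia.
    case: (ltnP l b') => bl''; last exact: hh.
    by rewrite cf_out ?bl'' ?orbT // ifF //; lia.
  rewrite !hh' //; try lia.
  have -> : (a + b.+1 = a.+1 + b)%N by lia.
  case: eqP => [e|_]; last by rewrite !mulr0 addr0.
  rewrite /=; have -> : n%:Z - a%:Z = b.+1%:Z by lia.
  by field; apply: (qbr_neq0 hO).
- by move=> a an; rewrite hh ?subnKC ?eqxx //; lia.
Qed.

(** B h is again singular of depth n, hence a multiple of h. At v_n (x) v_0, where B is the flip
    times a power of q, the factor is q^m / [hco q l n n], whose sign is (-1)^n. *)
Lemma singular_eigen n h : (n <= l)%N -> pure n h -> DE h = 0 ->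
  (forall a, (a <= n)%N -> cf a (n - a) h = hco q l n a) ->
  exists m : int, B h = ((-1) ^+ n * q ^ m) *: h.
Proof.
move=> nl hp hE hh.
have hBE : DE (B h) = 0 by rewrite -BE hE linear0.
have c := singular_coef nl (B_pure hp) hBE.
have e : B h = cf 0 n (B h) *: h.
  apply: cf_eq => a b al bl; rewrite linearZ /=.
  have [/eqP e|/eqP ne] := boolP (a + b == n)%N; last first.
    by rewrite (B_pure hp) // hp // mulr0.
  have -> : b = (n - a)%N by lia.
  by rewrite c ?hh; [rewrite mulrC|lia|lia].
have [m hm] := B_corner nl; have [m' hm'] := hco_last l hO n.
exists (m - m'); rewrite {1}e; congr (_ *: _).
have q0 := qadic_neq0 hO.
have hn0 : hco q l n n != 0 by rewrite hm' mulf_neq0 ?expfz_neq0 ?signr_eq0.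
apply: (mulfI hn0); rewrite -c // subnn hm.
have := hh 0%N (leq0n _); rewrite subn0 /= => ->; rewrite hm' mulr1.
rewrite mulrACA -exprD -expfzDr // addnn -mul2n exprM sqrrN expr1n expr1n mul1r.
by congr (q ^ _); lia.
Qed.

Lemma iterF_coef n h r : (n <= l)%N -> pure n h ->
  (forall a, (a <= n)%N -> cf a (n - a) h = hco q l n a) ->
  forall a b, (a <= l)%N -> (b <= l)%N ->
    cf a b (iter r DF h) = if (a + b == n + r)%N then gco q l n r b else 0.
Proof.
move=> nl hp hh; elim: r => [|r IH] a b al bl.
  rewrite addn0 /=; case: eqP => [e|ne]; last exact: hp.
  have -> : (b <= n)%N by lia.
  by rewrite -hh ?leq_subr // subKn; [congr (cf _ _ h); lia|lia].
rewrite iterS cfF // /dF.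
have -> : (if a is a'.+1 then qbr q (l%:Z - a'%:Z) * q ^ (b%:Z *+ 2 - l%:Z) *
      cf a' b (iter r DF h) else 0) =
    if (a + b == n + r.+1)%N then
      qbr q (l%:Z - (n + r)%:Z + b%:Z) * q ^ (b%:Z *+ 2 - l%:Z) * gco q l n r b else 0.
  case: a al => [|a] al.
    by case: eqP => // e; rewrite gco_eq0 ?mulr0 //; lia.
  rewrite IH ?(ltnW al) // addSn addnS eqSS.
  by case: eqP => [e|_]; [congr (qbr q _ * _ * _); lia|rewrite mulr0].
have -> : (if b is b'.+1 then qbr q (l%:Z - b'%:Z) * cf a b' (iter r DF h) else 0) =
   if (a + b == n + r.+1)%N then
     (if b is b'.+1 then qbr q (l%:Z - b'%:Z) * gco q l n r b' else 0) else 0.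
  case: b bl => [|b] bl; first by rewrite if_same.
  rewrite IH ?(ltnW bl) // !addnS eqSS; by case: ifP => // _; rewrite mulr0.
by case: eqP => [e|_] //; rewrite addr0.
Qed.

Lemma iterF_B r h c : B h = c *: h -> B (iter r DF h) = c *: iter r DF h.
Proof. by move=> h0; elim: r => //= r IH; rewrite BF IH linearZ. Qed.

Lemma odd_eigen_lowspan s (z : int) : B s = (- q ^ z) *: s ->
  lowspan q l (fun a b => cf a b s).
Proof.
move=> hs k kl; have q0 := qadic_neq0 hO.
(* The depth-k component of s is itself an eigenvector, since B preserves depth. *)
have [sk hsk] := cf_surj (fun a b => if (a + b == k)%N then cf a b s else 0).
have psk : pure k sk by move=> a b al bl /eqP/negbTE ne; rewrite hsk // ne.
have Bsk : B sk = (- q ^ z) *: sk.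
  apply: cf_eq => a b al bl; rewrite linearZ /=.
  have [/eqP e|/eqP ne] := boolP (a + b == k)%N; last first.
    by rewrite (B_pure psk) // psk // mulr0.
  rewrite hsk // e eqxx.
  have : cf a b (B (sk - s)) = 0.
    apply: (@B_depth _ k) => // a' b' al' bl' e'.
    by rewrite linearB /= hsk // e' eqxx subrr.
  rewrite linearB linearB /= hs linearZ /= => /eqP; rewrite subr_eq0 => /eqP ->.
  by [].
have [y hy] := gvec_span hO (fun b => cf (k - b)%N b s) kl.
have /choice [hv hhv] : forall n : nat, exists h : T, (n <= k)%N ->
  [/\ pure n h, DE h = 0 & forall a, (a <= n)%N -> cf a (n - a) h = hco q l n a].
  move=> n; case: (leqP n k) => nk; last by exists 0.
  by have [h hh] := singular_exists (leq_trans nk kl); exists h.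
have /choice [ev hev] : forall n : nat, exists m : int, (n <= k)%N ->
   B (hv n) = ((-1) ^+ n * q ^ m) *: hv n.
  move=> n; case: (leqP n k) => nk; last by exists 0.
  have [h1 h2 h3] := hhv n nk.
  by have [m hm] := singular_eigen (leq_trans nk kl) h1 h2 h3; exists m.
pose gv n : T := q ^ (- gexp l n (k - n)) *: iter (k - n) DF (hv n).
have cfg n a b : (n <= k)%N -> (a <= l)%N -> (b <= l)%N ->
   cf a b (gv n) = if (a + b == k)%N then gvec q l k n b else 0.
  move=> nk al bl; have [h1 h2 h3] := hhv n nk.
  rewrite linearZ /= (iterF_coef _ (leq_trans nk kl) h1 h3) // subnKC //.
  by case: ifP => // _; rewrite mulr0.
have Bg n : (n <= k)%N -> B (gv n) = ((-1) ^+ n * q ^ ev n) *: gv n.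
  by move=> nk; rewrite linearZ /= (iterF_B _ (hev n nk)) !scalerA mulrC.
have skE : sk = \sum_(n < k.+1) y n *: gv n.
  apply: cf_eq => a b al bl; rewrite hsk // linear_sum /=.
  have [/eqP e|/negbTE ne] := boolP (a + b == k)%N; last first.
    by rewrite big1 // => -[n nk] _; rewrite linearZ /= cfg // ne mulr0.
  have -> : a = (k - b)%N by lia.
  rewrite (hy b (ltac:(lia))); apply: eq_bigr => -[n nk] _.
  rewrite linearZ /= cfg //; last by lia.
  by rewrite subnK ?eqxx //; lia.
(* Compare B sk with -q^z sk in the basis of the [gv n], whose eigenvalues are (-1)^n q^(ev n). *)
have y0 n : (n <= k)%N -> y n * ((-1) ^+ n * q ^ ev n + q ^ z) = 0.
  move: n; apply: (gvec_free hO kl) => b bk.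
  have : cf (k - b)%N b (B sk - (- q ^ z) *: sk) = 0 by rewrite Bsk subrr linear0.
  rewrite skE linear_sum scaler_sumr -sumrB linear_sum /= => h.
  rewrite -[RHS]h; apply: eq_bigr => -[n nk] _ /=.
  have cg : cf (k - b)%N b (gv n) = gvec q l k n b.
    by rewrite cfg ?subnK ?eqxx //; lia.
  rewrite linearZ /= Bg //; move: (gv n) cg => w cg.
  by rewrite linearB /= !cfZ cg; ring.
exists y => b bk; rewrite (hy b bk) [RHS]big_mkcond; apply: eq_bigr => -[n nk] _ /=.
case: ifP => // /negbT on.
suff -> : y n = 0 by rewrite mul0r.
apply/eqP; have /eqP := y0 n nk; rewrite mulf_eq0 => /orP[//|/eqP].
rewrite -signr_odd (negbTE on) expr0 mul1r => /eqP; rewrite addr_eq0 => /eqP h.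
(* For even n, q^(ev n) = -q^z squares to q^(2(ev n - z)) = 1, so ev n = z and 2 = 0. *)
have e1 : q ^ (ev n - z) = -1.
  by rewrite expfzDr // h -invr_expz mulNr divff // expfz_neq0.
have : q ^ ((ev n - z) * 2) = 1 by rewrite -exprz_exp e1 -exprnP sqrrN expr1n.
move/q_inf => h2; have h3 : ev n - z = 0 by lia.
move: e1; rewrite h3 expr0z => /eqP; rewrite -addr_eq0.
by rewrite (negbTE two_neq0).
Qed.

End OddEigenvectors.

(** * Third and fourth powers *)

Section ExteriorFourth.
Variables (K : fieldType) (q : K) (l : nat) (O : K -> Prop).
Hypothesis hO : qadic q O.
Let q0 : q != 0 := qadic_neq0 hO.

(* [L2] stands for the exterior square, seen through its coefficients on the
   v_a (x) v_b. *)
Variable L2 : (nat -> nat -> K) -> Prop.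
Hypothesis L2_lin : forall c f g, L2 f -> L2 g -> L2 (fun a b => c * f a b + g a b).
Hypothesis L2_out : forall f a b, L2 f -> (l < a)%N || (l < b)%N -> f a b = 0.
Hypothesis L2E : forall f, L2 f -> L2 (dE q l f).
Hypothesis L2F : forall f, L2 f -> L2 (dF q l f).
Hypothesis L2K : forall (m : int) f, L2 f -> L2 (fun a b => q ^ (m * (a + b)%N%:Z) * f a b).
Hypothesis L2_low : forall f, L2 f -> lowspan q l f.
Hypothesis L2_high : forall f, L2 f -> lowspan q l (fun a b => f (l - b)%N (l - a)%N).

Definition L3 (t : nat -> nat -> nat -> K) : Prop :=
  (forall a, L2 (t a)) /\ (forall c, L2 (fun a b => t a b c)).

Definition L4 (t : nat -> nat -> nat -> nat -> K) : Prop :=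
  (forall a, L3 (t a)) /\ (forall d, L3 (fun a b c => t a b c d)).

Lemma L2_ext f g : (forall a b, f a b = g a b) -> L2 f -> L2 g.
Proof.
by move=> e; rewrite (_ : f = g) //; apply/funext => a; apply/funext => b.
Qed.

Lemma L3_ext f g : (forall a b c, f a b c = g a b c) -> L3 f -> L3 g.
Proof.
move=> e; rewrite (_ : f = g) //.
by apply/funext => a; apply/funext => b; apply/funext => c.
Qed.

Lemma L2Z c f : L2 f -> L2 (fun a b => c * f a b).
Proof. by move=> h; apply: L2_ext (L2_lin (c - 1) h h) => a b /=; ring. Qed.

Lemma L3_lin c f g : L3 f -> L3 g -> L3 (fun x y z => c * f x y z + g x y z).
Proof. by move=> [f1 f2] [g1 g2]; split=> [a|z]; apply: L2_lin. Qed.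

Lemma L3Z c f : L3 f -> L3 (fun x y z => c * f x y z).
Proof. by move=> [f1 f2]; split=> [a|z]; apply: L2Z. Qed.

Lemma L3K (m : int) f : L3 f -> L3 (fun a b c => q ^ (m * (a + b + c)%N%:Z) * f a b c).
Proof.
move=> [f1 f2]; split=> [a|c].
  apply: L2_ext (L2Z (q ^ (m * a%:Z)) (L2K m (f1 a))) => b c.
  by rewrite mulrA -expfzDr //; congr (q ^ _ * _); lia.
apply: L2_ext (L2Z (q ^ (m * c%:Z)) (L2K m (f2 c))) => a b.
by rewrite mulrA -expfzDr //; congr (q ^ _ * _); lia.
Qed.

Definition dE3 (t : nat -> nat -> nat -> K) (a b c : nat) : K :=
  qbr q a.+1%:Z * t a.+1 b c + q ^ (l%:Z - a%:Z *+ 2) * dE q l (t a) b c.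

Definition dE4 (t : nat -> nat -> nat -> nat -> K) (a b c d : nat) : K :=
  qbr q a.+1%:Z * t a.+1 b c d + q ^ (l%:Z - a%:Z *+ 2) * dE3 (t a) b c d.

Definition dF3 (t : nat -> nat -> nat -> K) (a b c : nat) : K :=
  (if a is a'.+1 then
     qbr q (l%:Z - a'%:Z) * q ^ ((b + c)%N%:Z *+ 2 - l%:Z *+ 2) * t a' b c else 0) +
  dF q l (t a) b c.

(** By coassociativity the iterated coproduct of E is both E (x) 1 + K (x) Delta(E) and Delta(E) (x)
    1 + Delta(K) (x) E. The first form preserves the condition on slots 2, 3, the second that on
    slots 1, 2, where Delta(K) acts by q^(2l - 2(a+b)). *)
Lemma L3E t : L3 t -> L3 (dE3 t).
Proof.
move=> [t1 t2]; split=> [a|c].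
  by apply: L2_lin => //; apply: L2Z; apply: L2E.
apply: L2_ext (L2_lin (q ^ (l%:Z *+ 2) * qbr q c.+1%:Z) (L2K (-2) (t2 c.+1)) (L2E (t2 c))).
move=> a b; rewrite /dE3 /dE.
have -> : q ^ (l%:Z *+ 2) * qbr q c.+1%:Z * (q ^ (-2 * (a + b)%N%:Z) * t a b c.+1) =
   q ^ (l%:Z *+ 2) * q ^ (-2 * (a + b)%N%:Z) * qbr q c.+1%:Z * t a b c.+1 by ring.
rewrite -expfzDr //.
have -> : l%:Z *+ 2 + -2 * (a + b)%N%:Z = (l%:Z - a%:Z *+ 2) + (l%:Z - b%:Z *+ 2) by lia.
by rewrite expfzDr //; ring.
Qed.

Lemma L3F t : L3 t -> L3 (dF3 t).
Proof.
move=> [t1 t2]; split=> [a|c].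
  case: a => [|a].
    by apply: L2_ext (L2F (t1 0%N)) => b c; rewrite /dF3 add0r.
  apply: L2_ext (L2_lin (qbr q (l%:Z - a%:Z) * q ^ (- l%:Z *+ 2)) (L2K 2 (t1 a)) (L2F (t1 a.+1))).
  move=> b c; rewrite /dF3; congr (_ + _) => /=.
  have -> : (b + c)%N%:Z *+ 2 - l%:Z *+ 2 = - l%:Z *+ 2 + 2 * (b + c)%N%:Z by lia.
  by rewrite (expfzDr (- l%:Z *+ 2) _ q0); ring.
have hc : L2 (fun a b => if c is c'.+1 then qbr q (l%:Z - c'%:Z) * t a b c' else 0).
  case: c => [|c]; last exact: L2Z.
  by apply: L2_ext (L2Z 0 (t2 0%N)) => a b; rewrite mul0r.
apply: L2_ext (L2_lin (q ^ (c%:Z *+ 2 - l%:Z)) (L2F (t2 c)) hc) => a b.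
rewrite /dF3 /dF addrA; congr (_ + _).
case: a => [|a]; case: b => [|b]; rewrite ?(mulr0, addr0, add0r) //=; try ring.
- have -> : (0 + c)%N%:Z *+ 2 - l%:Z *+ 2 = (c%:Z *+ 2 - l%:Z) + - l%:Z by lia.
  by rewrite (expfzDr (c%:Z *+ 2 - l%:Z) _ q0); ring.
have -> : (b.+1 + c)%N%:Z *+ 2 - l%:Z *+ 2 = (c%:Z *+ 2 - l%:Z) + (b.+1%:Z *+ 2 - l%:Z) by lia.
by rewrite (expfzDr (c%:Z *+ 2 - l%:Z) _ q0); ring.
Qed.

Lemma L4E t : L4 t -> L4 (dE4 t).
Proof.
move=> [t1 t2]; split=> [a|d].
  by apply: L3_lin => //; apply: L3Z; apply: L3E.
apply: L3_ext (L3_lin (q ^ (l%:Z *+ 3) * qbr q d.+1%:Z) (L3K (-2) (t2 d.+1)) (L3E (t2 d))).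
move=> a b c; rewrite /dE4 /dE3 /dE.
have -> : q ^ (l%:Z *+ 3) * qbr q d.+1%:Z * (q ^ (-2 * (a + b + c)%N%:Z) * t a b c d.+1) =
   q ^ (l%:Z *+ 3) * q ^ (-2 * (a + b + c)%N%:Z) * qbr q d.+1%:Z * t a b c d.+1 by ring.
rewrite -expfzDr //.
have -> : l%:Z *+ 3 + -2 * (a + b + c)%N%:Z =
  (l%:Z - a%:Z *+ 2) + ((l%:Z - b%:Z *+ 2) + (l%:Z - c%:Z *+ 2)) by lia.
by rewrite (expfzDr (l%:Z - a%:Z *+ 2) _ q0) (expfzDr (l%:Z - b%:Z *+ 2) _ q0); ring.
Qed.

Lemma L3_low t a b c : L3 t -> (a + b + c <= l)%N -> t a b c = 0.
Proof.
move=> [t1 t2] h; apply: (triple_eq0 hO _ _ h) => // [a'|c'].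
  exact: L2_low.
exact: (L2_low (t2 c')).
Qed.

(** The reversal a -> l - a reverses the order of the slots as well, so the conditions on slots 1, 2
    and 2, 3 change places; the depth becomes 3l - (a + b + c) <= l. *)
Lemma L3_high t a b c : L3 t -> (l *+ 2 <= a + b + c)%N -> t a b c = 0.
Proof.
move=> [t1 t2] h.
have [al|al] := ltnP l a; first by apply: (L2_out (t2 c)); rewrite al.
have [bl|bl] := ltnP l b; first by apply: (L2_out (t1 a)); rewrite bl.
have [cl|cl] := ltnP l c; first by apply: (L2_out (t1 a)); rewrite cl orbT.
have := @triple_eq0 _ q l _ hO (fun x y z => t (l - z)%N (l - y)%N (l - x)%N) _ _
   _ _ (l - c)%N (l - b)%N (l - a)%N erefl.
rewrite !subKn //; apply; [|move=> z|lia].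
  by move=> x; apply: (L2_high (t2 (l - x)%N)).
by apply: (L2_high (t1 (l - z)%N)).
Qed.

(** For j = 0 the depth m + l is at least 2l. Otherwise apply F and read the coefficient at (a, b, l
    - j + 1) for the previous j: the terms where F acts on slots 1, 2 have a + b < m there and
    vanish, leaving [j] z a b (l - j). *)
Lemma L3_lowered j z m : L3 z -> (l <= m)%N -> (j <= l)%N ->
  (forall a b c, (a + b < m)%N -> z a b c = 0) ->
  forall a b, (a + b)%N = m -> z a b (l - j)%N = 0.
Proof.
elim: j z => [|j IH] z hz lm jl zm a b abm.
  by apply: L3_high => //; lia.
have := IH _ (L3F hz) lm (ltnW jl) _ a b abm.
have -> : (l - j = (l - j.+1).+1)%N by lia.
rewrite /dF3 /dF => h; have {h} := h _.
have z1 : (if a is a'.+1 then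
     qbr q (l%:Z - a'%:Z) * q ^ ((b + (l - j.+1).+1)%N%:Z *+ 2 - l%:Z *+ 2) *
     z a' b (l - j.+1).+1 else 0) = 0.
  by case: a abm => // a abm; rewrite zm ?mulr0 //; lia.
rewrite z1 add0r.
have -> : (if b is b'.+1 then
     qbr q (l%:Z - b'%:Z) * q ^ ((l - j.+1).+1%:Z *+ 2 - l%:Z) *
     z a b' (l - j.+1).+1 else 0) = 0.
  by case: b abm {z1} => // b abm; rewrite zm ?mulr0 //; lia.
rewrite add0r => h; apply/eqP; move: h => /(_ _)/eqP.
rewrite mulf_eq0 => h; have {h} := h _.
have -> : l%:Z - (l - j.+1)%N%:Z = j.+1%:Z by lia.
rewrite (negbTE (qbr_neq0 hO _)) //=; apply=> a' b' c' abm'.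
have -> : (if a' is a''.+1 then
     qbr q (l%:Z - a''%:Z) * q ^ ((b' + c')%N%:Z *+ 2 - l%:Z *+ 2) * z a'' b' c' else 0) = 0.
  by case: a' abm' => // a' abm'; rewrite zm ?mulr0 //; lia.
have -> : (if b' is b''.+1 then
     qbr q (l%:Z - b''%:Z) * q ^ (c'%:Z *+ 2 - l%:Z) * z a' b'' c' else 0) = 0.
  by case: b' abm' => // b' abm'; rewrite zm ?mulr0 //; lia.
by case: c' => [|c']; rewrite ?(zm a' b') ?mulr0 ?addr0.
Qed.

Lemma L3_eq0 z : L3 z -> (forall a b c, (a + b <= l)%N -> z a b c = 0) ->
  forall a b c, z a b c = 0.
Proof.
move=> hz z0.
have H m : forall a b c, (a + b < l.+1 + m)%N -> z a b c = 0.
  elim: m => [|m IH] a b c ab; first by apply: z0; lia.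
  case: (ltnP (a + b) (l.+1 + m)) => ab'; first exact: IH.
  have [cl|cl] := ltnP l c; first by apply: (L2_out (hz.1 a)); rewrite cl orbT.
  rewrite -(subKn cl); apply: (@L3_lowered _ _ (a + b)%N) => //; try lia.
  by move=> a' b' c' ab''; apply: IH; lia.
by move=> a b c; apply: (H (a + b)%N); lia.
Qed.

Lemma L4_eq0 t : L4 t -> forall a b c d, t a b c d = 0.
Proof.
move=> h a; elim: a t h => [|a IH] t h b c d.
  apply: L3_eq0 (h.1 0%N) _ b c d => b c d bc.
  by apply: (L3_low (h.2 d)); lia.
(* The induction hypothesis holds for [dE4 t] and for t; of the terms of [dE4 t] only [a+1] t_(a+1)
   has first index different from a. *)
have := IH _ (L4E h) b c d; rewrite /dE4 /dE3 /dE !IH //.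
rewrite !(mulr0, addr0) => /eqP; rewrite mulf_eq0.
by rewrite (negbTE (qbr_neq0 hO _)) //= => /eqP.
Qed.

End ExteriorFourth.

(** * The simple module in coordinates *)

Definition wt (l a : nat) : weight := (l%:Z - a%:Z, a%:Z).

(** Setting v_a = 0 beyond l makes the formula for F uniform, including at v_l. *)
Record standard_basis (K : fieldType) (q : K) (I : finType) (M : uqgl2_module q I)
    (l : nat) (vb : nat -> coordspace K I) : Prop := StandardBasis {
  sb_basis : basis_of fullv [tuple of mkseq vb l.+1];
  sb_out : forall a, (l < a)%N -> vb a = 0;
  sb_wt : forall a, weight_space M (wt l a) (vb a);
  sb_E0 : opE M (vb 0) = 0;
  sb_E : forall a, (a < l)%N -> opE M (vb a.+1) = qbr q a.+1%:Z *: vb a;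
  sb_F : forall a, opF M (vb a) = qbr q (l%:Z - a%:Z) *: vb a.+1
}.

Section StandardBasis.
Variables (K : fieldType) (q : K) (O : K -> Prop).
Hypothesis hO : qadic q O.
Hypothesis q_inf : forall m : int, q ^ m = 1 -> m = 0.
Let q0 : q != 0 := qadic_neq0 hO.

Lemma qbr_eq0 (m : int) : qbr q m = 0 -> m = 0.
Proof.
move/eqP; rewrite mulf_eq0 invr_eq0 (negbTE (qqV_neq0 hO)) orbF subr_eq0 => /eqP.
by move/(q_inj q0 q_inf) => h; lia.
Qed.

Variables (I : finType) (M : uqgl2_module q I) (l : nat).
Notation V := (coordspace K I).
Variable v0 : V.
Hypotheses (v0_neq0 : v0 != 0) (v0_wt : weight_space M (l%:Z, 0) v0) (v0E : opE M v0 = 0).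

Lemma wtE a : wt l a = (l%:Z, 0) - alpha *+ a.
Proof.
elim: a => [|a IH]; first by rewrite mulr0n /wt !subr0.
by rewrite mulrSr opprD addrA -IH /wt /alpha; congr (_, _) => /=; lia.
Qed.

Notation fv k := (lfun_pow (opF M) k v0).

Lemma fv_wt k : weight_space M (wt l k) (fv k).
Proof. by rewrite wtE; apply: weightFk. Qed.

Lemma fvE k : opE M (fv k.+1) = (qbr q k.+1%:Z * qbr q (l%:Z - k%:Z)) *: fv k.
Proof.
rewrite (opEFk q0 q_inf k v0_wt) v0E linear0 add0r; congr ((_ * qbr q _) *: _).
by rewrite /ip /alpha /=; lia.
Qed.

Lemma fv_top_neq0 k : (k <= l)%N -> fv k != 0.
Proof.
elim: k => [|k IH] kl; first by rewrite lfun_pow0.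
apply/eqP => h; have /eqP := fvE k; rewrite h linear0 eq_sym scaler_eq0.
rewrite (negbTE (IH (ltnW kl))) orbF mulf_eq0 (negbTE (qbr_neq0 hO _)) //=.
by move=> /eqP/qbr_eq0; lia.
Qed.

(** F is nilpotent on v0. If F^(m+1) v0 = 0 with m minimal, applying E gives [m+1][l-m] = 0, so m =
    l. *)
Lemma fv_eq0 k : (l < k)%N -> fv k = 0.
Proof.
have ex : exists m, fv m == 0 by exists #|I|; rewrite (opF_nilp q0 q_inf v0_wt).
have := ex_minnP ex; case=> -[|m] /eqP hm min.
  by move: v0_neq0; rewrite -hm lfun_pow0 eqxx.
have nz : fv m != 0 by apply/negP => /min; rewrite ltnn.
have : l%:Z - m%:Z = 0.
  apply: qbr_eq0; have /eqP := fvE m; rewrite hm linear0 eq_sym scaler_eq0.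
  by rewrite (negbTE nz) orbF mulf_eq0 (negbTE (qbr_neq0 hO _)) //= => /eqP.
move=> lm; have -> : l = m by lia.
elim: k => // k IH; rewrite ltnS leq_eqVlt => /orP[/eqP <- //|/IH h].
by rewrite lfun_powS h linear0.
Qed.

(** Division by [l]..[l-a+1] normalises E to [a] and F to [l-a]. For a > l the product contains [0],
    but F^a v0 vanishes. *)
Definition vb (a : nat) : V := (\prod_(i < a) qbr q (l%:Z - i%:Z))^-1 *: fv a.

Lemma vb_wt a : weight_space M (wt l a) (vb a).
Proof. by move=> m; rewrite linearZ /= fv_wt !scalerA mulrC. Qed.

Lemma vb_out a : (l < a)%N -> vb a = 0.
Proof. by move=> h; rewrite /vb fv_eq0 ?scaler0. Qed.

Lemma qfall_neq0 a : (a <= l)%N -> \prod_(i < a) qbr q (l%:Z - i%:Z) != 0.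
Proof.
move=> al; apply/prodf_neq0 => i _; apply/eqP => /qbr_eq0.
by have := ltn_ord i; lia.
Qed.

Lemma vb_neq0 a : (a <= l)%N -> vb a != 0.
Proof.
by move=> al; rewrite scaler_eq0 negb_or invr_eq0 qfall_neq0 // fv_top_neq0.
Qed.

Lemma vbF a : opF M (vb a) = qbr q (l%:Z - a%:Z) *: vb a.+1.
Proof.
have [la|al] := leqP l a.
  rewrite (vb_out (_ : l < a.+1)%N) // scaler0 linearZ /= -lfun_powS.
  by rewrite fv_eq0 // scaler0.
rewrite linearZ /= -lfun_powS /vb scalerA big_ord_recr /= invfM mulrCA.
rewrite mulfV ?mulr1 //; apply/eqP => /qbr_eq0; lia.
Qed.

Lemma vbE0 : opE M (vb 0) = 0.
Proof. by rewrite linearZ /= lfun_pow0 v0E scaler0. Qed.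

Lemma vbE a : (a < l)%N -> opE M (vb a.+1) = qbr q a.+1%:Z *: vb a.
Proof.
move=> al; rewrite linearZ /= fvE /vb !scalerA big_ord_recr /=; congr (_ *: _).
have h1 := qfall_neq0 (ltnW al).
have h2 : qbr q (l%:Z - a%:Z) != 0 by apply/eqP => /qbr_eq0; lia.
by field; rewrite h1 h2.
Qed.

Hypothesis hsimple : simple_module M.

Definition vbt : l.+1.-tuple V := [tuple of mkseq vb l.+1].

Lemma vbt_mem a : (a <= l)%N -> vb a \in <<vbt>>%VS.
Proof.
move=> al; apply: memv_span; rewrite /= /mkseq.
by apply: map_f; rewrite mem_iota.
Qed.

Lemma vbt_free : free vbt.
Proof.
have h := @free_eigen _ _ (opK M alpha) (fun k => q ^ ip alpha (wt l k)) vb l.+1 _ _ _.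
rewrite -(@perm_free _ _ [seq vb k | k <- rev (iota 0 l.+1)]); last first.
  by apply: perm_map; rewrite perm_rev.
apply: h.
- move=> k k' /(q_inj q0 q_inf); rewrite /ip /alpha /=; lia.
- by move=> k; apply: vb_wt.
- by move=> k kl; apply: vb_neq0.
Qed.

(** The span of the v_a is a nonzero submodule, so it is everything by simplicity. *)
Lemma vbt_basis : basis_of fullv vbt.
Proof.
rewrite /basis_of vbt_free andbT; apply/eqP.
have sub (f : 'End(V)) : (forall a, (a <= l)%N -> f (vb a) \in <<vbt>>%VS) ->
    (f @: <<vbt>> <= <<vbt>>)%VS.
  move=> hf; rewrite limg_span; apply/span_subvP => _ /mapP[_ /mapP[a + ->] ->].
  by rewrite mem_iota => al; apply: hf.
have subM : submodule M <<vbt>>%VS.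
  split; first 1 last.
  - apply: sub => a al; rewrite vbF; have [la|al'] := leqP l a.
      by rewrite vb_out // scaler0 mem0v.
    by rewrite memvZ // vbt_mem.
  - by move=> m; apply: sub => a al; rewrite vb_wt memvZ // vbt_mem.
  apply: sub => -[|a] al; first by rewrite vbE0 mem0v.
  by rewrite vbE // memvZ // vbt_mem // ltnW.
have [h|//] := hsimple.2 _ subM.
have := vbt_mem (leq0n l); rewrite h memv0.
by rewrite (negbTE (vb_neq0 (leq0n l))).
Qed.

Lemma vb_standard : standard_basis M l vb.
Proof.
by split; [exact: vbt_basis|exact: vb_out|exact: vb_wt|exact: vbE0|exact: vbE|exact: vbF].
Qed.

End StandardBasis.

(** * Coordinate functionals on V and V (x) V *)

Section Coordinates.
Variables (K : fieldType) (q : K) (I : finType) (M : uqgl2_module q I) (l : nat).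
Variable vb : nat -> coordspace K I.
Hypothesis hv : standard_basis M l vb.
Notation V := (coordspace K I).
Notation vbt := [tuple of mkseq vb l.+1].

Let vb_out := sb_out hv.
Let vbE0 := sb_E0 hv.
Let vbE := sb_E hv.
Let vbF := sb_F hv.
Let vb_wt := sb_wt hv.
Let vbt_basis := sb_basis hv.

(** The guard is needed because [inord a] is 0 for a > l. *)
Definition co (a : nat) (u : V) : K :=
  if (a <= l)%N then coord vbt (inord a) u else 0.

Lemma co_scalar a : scalar (co a).
Proof.
by move=> c u v; rewrite /co; case: ifP => _; rewrite ?linearP //= mulr0 addr0.
Qed.
HB.instance Definition _ a := GRing.isLinear.Build K V K *%R (co a) (co_scalar a).

Lemma co_out a u : (l < a)%N -> co a u = 0.
Proof. by rewrite /co ltnNge => /negbTE ->. Qed.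

Lemma co_vb a x : (x <= l)%N -> co a (vb x) = (a == x)%:R.
Proof.
move=> xl; rewrite /co; case: leqP => al; last by case: eqP => // e; lia.
have -> : vb x = vbt`_(inord x : 'I_l.+1) by rewrite nth_mkseq inordK.
rewrite coord_free ?(basis_free vbt_basis) //; congr (_%:R); congr nat_of_bool.
by rewrite -val_eqE /= !inordK.
Qed.

Lemma co_sum u : u = \sum_(a < l.+1) co a u *: vb a.
Proof.
rewrite {1}(coord_basis vbt_basis (memvf u)); apply: eq_bigr => a _.
by rewrite nth_mkseq // /co -ltnS ltn_ord inord_val.
Qed.

Lemma co_ext (f : 'End(V)) a a' c :
  (forall x, (x <= l)%N -> co a (f (vb x)) = c * co a' (vb x)) ->
  forall u, co a (f u) = c * co a' u.
Proof.
move=> h u; rewrite (co_sum u) !linear_sum /= mulr_sumr; apply: eq_bigr => x _.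
by rewrite !linearZ /= h ?leq_ord // mulrCA.
Qed.

Lemma co_opE a u : co a (opE M u) = qbr q a.+1%:Z * co a.+1 u.
Proof.
have [la|al] := ltnP l a; first by rewrite !co_out ?mulr0 // ltnW.
apply: co_ext => -[|x] xl; first by rewrite vbE0 linear0 co_vb // mulr0.
rewrite vbE // linearZ /= !co_vb ?(ltnW xl) // eqSS.
by case: eqP => [->|]; rewrite ?mulr0.
Qed.

Lemma co_opF0 u : co 0 (opF M u) = 0.
Proof.
rewrite (@co_ext (opF M) 0 0 0) ?mul0r // => x xl; rewrite vbF linearZ /= mul0r.
have [lx|xl'] := leqP l x; first by rewrite vb_out // linear0 mulr0.
by rewrite co_vb // mulr0.
Qed.

Lemma co_opF a u : co a.+1 (opF M u) = qbr q (l%:Z - a%:Z) * co a u.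
Proof.
have [la|al] := ltnP l a; first by rewrite !co_out ?mulr0 // ltnW.
apply: co_ext => x xl; rewrite vbF linearZ /=.
have [lx|xl'] := leqP l x.
  rewrite vb_out // linear0 mulr0 co_vb //; case: eqP => [e|]; last by rewrite mulr0.
  by rewrite (_ : l%:Z - a%:Z = 0) ?qbrz0 ?mul0r //; lia.
by rewrite !co_vb // eqSS; case: eqP => [->|]; rewrite ?mulr0.
Qed.

Lemma co_opK m a u : co a (opK M m u) = q ^ ip m (wt l a) * co a u.
Proof.
apply: co_ext => x xl; rewrite vb_wt linearZ /= co_vb //.
by case: eqP => [->//|_]; rewrite !mulr0.
Qed.

(** The clause on c compensates the truncated subtraction a - k. *)
Lemma co_powF k a : exists c, (forall u, co a (lfun_pow (opF M) k u) = c * co (a - k) u)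
  /\ ((a < k)%N -> c = 0).
Proof.
elim: k a => [|k IH] a.
  by exists 1; split=> // u; rewrite lfun_pow0 subn0 mul1r.
case: a => [|a].
  by exists 0; split=> // u; rewrite lfun_powS co_opF0 mul0r.
have [c [hc c0]] := IH a; exists (qbr q (l%:Z - a%:Z) * c); split=> [u|ak].
  by rewrite lfun_powS co_opF hc subSS mulrA.
by rewrite c0 ?mulr0.
Qed.

Lemma co_powE k b : exists c, forall u, co b (lfun_pow (opE M) k u) = c * co (b + k) u.
Proof.
elim: k b => [|k IH] b; first by exists 1 => u; rewrite lfun_pow0 addn0 mul1r.
have [c hc] := IH b.+1; exists (qbr q b.+1%:Z * c) => u.
by rewrite lfun_powS co_opE hc addSnnS mulrA.
Qed.

Notation T := (coordspace K (I * I)%type).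

(** The functional [co a] (x) [co b], expanded on standard vectors. *)
Definition cf (a b : nat) (w : T) : K :=
  \sum_p \sum_r (w (p, r) : K) * (co a (stdvec K p) * co b (stdvec K r)).

Lemma cf_scalar a b : scalar (cf a b).
Proof.
move=> c u v; rewrite /cf mulr_sumr -big_split; apply: eq_bigr => p _ /=.
rewrite mulr_sumr -big_split; apply: eq_bigr => r _ /=.
by rewrite !ffunE /GRing.scale /= mulrDl -mulrA.
Qed.
HB.instance Definition _ a b := GRing.isLinear.Build K T K *%R (cf a b) (cf_scalar a b).

Lemma cf_out a b s : (l < a)%N || (l < b)%N -> cf a b s = 0.
Proof.
move=> h; rewrite /cf big1 // => p _; rewrite big1 // => r _.
by case/orP: h => h; [rewrite (co_out (stdvec K p) h) mul0r mulr0|rewrite (co_out (stdvec K r) h) !mulr0].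
Qed.

Lemma tens_std (w : T) :
  w = \sum_p \sum_r (w (p, r) : K) *: tens (stdvec K p) (stdvec K r).
Proof.
rewrite pair_bigA {1}[w]stdvecE /=; apply: eq_bigr => -[i j] _; congr (_ *: _).
by apply/ffunP => -[i' j']; rewrite !ffunE /= xpair_eqE -natrM mulnb.
Qed.

Lemma cf_tens a b u v : cf a b (tens u v) = co a u * co b v.
Proof.
rewrite /cf [in RHS](stdvecE u) [in RHS](stdvecE v) !linear_sum /= mulr_suml.
apply: eq_bigr => p _; rewrite mulr_sumr; apply: eq_bigr => r _.
by rewrite !linearZ /= !ffunE mulrACA.
Qed.

Lemma cf_tens_lfun (f g : 'End(V)) a b a' b' c d :
  (forall u, co a (f u) = c * co a' u) -> (forall u, co b (g u) = d * co b' u) ->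
  forall s, cf a b (tens_lfun f g s) = c * d * cf a' b' s.
Proof.
move=> hf hg s; rewrite {1}(tens_std s) !linear_sum /= mulr_sumr.
apply: eq_bigr => p _; rewrite !linear_sum /= mulr_sumr; apply: eq_bigr => r _.
by rewrite !linearZ /= tens_lfunE cf_tens hf hg; ring.
Qed.

Lemma cf_rec s : s = \sum_(a < l.+1) \sum_(b < l.+1) cf a b s *: tens (vb a) (vb b).
Proof.
rewrite {1}(tens_std s).
transitivity (\sum_p \sum_r \sum_(a < l.+1) \sum_(b < l.+1)
   ((s (p, r) : K) * (co a (stdvec K p) * co b (stdvec K r))) *: tens (vb a) (vb b)).
  apply: eq_bigr => p _; apply: eq_bigr => r _.
  rewrite {1}(co_sum (stdvec K p)) {1}(co_sum (stdvec K r)) tens_bilin.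
  rewrite scaler_sumr; apply: eq_bigr => a _; rewrite scaler_sumr.
  by apply: eq_bigr => b _; rewrite scalerA.
rewrite pair_bigA exchange_big /=; apply: eq_bigr => a _.
rewrite exchange_big /=; apply: eq_bigr => b _.
by rewrite /cf pair_bigA scaler_suml.
Qed.

Lemma cf_inj s :
  (forall a b, (a <= l)%N -> (b <= l)%N -> cf a b s = 0) -> s = 0.
Proof.
move=> h; rewrite (cf_rec s) big1 // => a _; rewrite big1 // => b _.
by rewrite h ?scale0r // -ltnS.
Qed.

Lemma cf_surj (f : nat -> nat -> K) : exists s,
  forall a b, (a <= l)%N -> (b <= l)%N -> cf a b s = f a b.
Proof.
exists (\sum_(a < l.+1) \sum_(b < l.+1) f a b *: tens (vb a) (vb b)) => a b al bl.
rewrite linear_sum /= (bigD1 (Ordinal (al : (a < l.+1)%N))) //= linear_sum /=.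
rewrite (bigD1 (Ordinal (bl : (b < l.+1)%N))) //= linearZ /= cf_tens !co_vb // !eqxx.
rewrite big1 => [|i ib]; last first.
  rewrite linearZ /= cf_tens [co b _]co_vb ?leq_ord //.
  by rewrite [b == i]eq_sym (negbTE (_ : (i != b :> nat))) ?mulr0.
rewrite big1 ?addr0 ?mulr1 // => i ia; rewrite linear_sum /= big1 // => j _.
rewrite linearZ /= cf_tens co_vb ?leq_ord //.
by rewrite [a == i]eq_sym (negbTE (_ : (i != a :> nat))) ?mul0r ?mulr0.
Qed.

Lemma cf_DeltaE s a b : cf a b (DeltaE M M s) = dE q l (fun a b => cf a b s) a b.
Proof.
rewrite add_lfunE linearD /= (cf_tens_lfun (co_opE a) (c := _) (d := 1) (b' := b));
  last by move=> u; rewrite id_lfunE mul1r.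
rewrite (cf_tens_lfun (co_opK alpha a) (co_opE b)) /dE mulr1.
by congr (_ + q ^ _ * _ * _); rewrite /ip /alpha /wt /=; lia.
Qed.

Lemma cf_DeltaF s a b : cf a b (DeltaF M M s) = dF q l (fun a b => cf a b s) a b.
Proof.
rewrite add_lfunE linearD /=; congr (_ + _).
  case: a => [|a].
    rewrite (cf_tens_lfun (a' := 0) (b' := b) (c := 0) _ (co_opK (- alpha) b)).
      by rewrite !mul0r.
    by move=> u; rewrite co_opF0 mul0r.
  rewrite (cf_tens_lfun (co_opF a) (co_opK (- alpha) b)).
  by congr (_ * q ^ _ * _); rewrite /ip /alpha /wt /=; lia.
have id1 u : co a ((\1%VF : 'End(V)) u) = 1 * co a u by rewrite id_lfunE mul1r.
case: b => [|b].
  rewrite (cf_tens_lfun id1 (d := 0) (b' := 0)); first by rewrite mulr0 mul0r.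
  by move=> u; rewrite co_opF0 mul0r.
by rewrite (cf_tens_lfun id1 (co_opF b)) mul1r.
Qed.

Lemma cf_DeltaK (q0 : q != 0) (m : int) s a b :
  cf a b (DeltaK M M (0, m) s) = q ^ (m * (a + b)%N%:Z) * cf a b s.
Proof.
rewrite (cf_tens_lfun (co_opK _ a) (co_opK _ b)) -expfzDr //.
by congr (q ^ _ * _); rewrite /ip /wt /=; lia.
Qed.

End Coordinates.

(** * The braided exterior square in coordinates *)

Lemma flipE (K : fieldType) (I J : finType) (t : coordspace K (I * J)%type) p :
  flip K I J t p = t (p.2, p.1).
Proof.
have L : linear (fun t : coordspace K (I * J)%type =>
    [ffun p => t (p.2, p.1)] : coordspace K (J * I)%type).
  by move=> c s s'; apply/ffunP => x; rewrite !ffunE.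
pose phi : {linear _ -> _} := HB.pack (fun t : coordspace K (I * J)%type =>
    [ffun p => t (p.2, p.1)] : coordspace K (J * I)%type)
    (GRing.isLinear.Build _ _ _ _ _ L).
by rewrite (lfunE phi) ffunE.
Qed.

Lemma flip_tens (K : fieldType) (I J : finType) (u : coordspace K I) (v : coordspace K J) :
  flip K I J (tens u v) = tens v u.
Proof. by apply/ffunP => p; rewrite flipE !ffunE mulrC. Qed.

Lemma flip_tens_lfun (K : fieldType) (I : finType) (f g : 'End(coordspace K I)) s :
  flip K I I (tens_lfun f g s) = tens_lfun g f (flip K I I s).
Proof.
rewrite (tens_std s) !linear_sum; apply: eq_bigr => p _.
rewrite !linear_sum; apply: eq_bigr => r _.
by rewrite !linearZ /= tens_lfunE !flip_tens tens_lfunE.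
Qed.

(** * Closure properties of linear spans *)

Section LspanClosure.
Variables (K : fieldType) (V : lmodType K) (S : set V).

Lemma lspan_sub x : S x -> lspan S x.
Proof.
by move=> Sx; exists 1%N, (fun=> 1), (fun=> x); split=> //; rewrite big_ord1 scale1r.
Qed.

Lemma lspan0 : lspan S 0.
Proof. by exists 0%N, (fun=> 0), (fun=> 0); split=> [[]//|]; rewrite big_ord0. Qed.

Lemma lspanD x y : lspan S x -> lspan S y -> lspan S (x + y).
Proof.
move=> [m [a [s [hs ->]]]] [n [b [r [hr ->]]]].
exists (m + n)%N, (fun i => match split i with inl j => a j | inr j => b j end),
  (fun i => match split i with inl j => s j | inr j => r j end); split.
  by move=> i; case: (split i).
rewrite big_split_ord /=; congr (_ + _); apply: eq_bigr => i _.
  by rewrite (unsplitK (inl i)).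
by rewrite (unsplitK (inr i)).
Qed.

Lemma lspanZ c x : lspan S x -> lspan S (c *: x).
Proof.
move=> [m [a [s [hs ->]]]]; exists m, (fun i => c * a i), s; split=> //.
by rewrite scaler_sumr; apply: eq_bigr => i _; rewrite scalerA.
Qed.

Lemma lspan_sum (J : Type) (r : seq J) (P : pred J) (f : J -> V) :
  (forall j, P j -> lspan S (f j)) -> lspan S (\sum_(j <- r | P j) f j).
Proof.
by move=> h; apply: (big_ind (lspan S)) => //; [exact: lspan0|move=> x y; exact: lspanD].
Qed.

Lemma lspan_ind (P : V -> Prop) : (forall x, S x -> P x) -> P 0 ->
  (forall c x y, P x -> P y -> P (c *: x + y)) -> forall x, lspan S x -> P x.
Proof.
move=> hS h0 hlin _ [m [a [s [hs ->]]]].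
elim/big_rec: _ => // i x _ Px; apply: hlin => //; exact: hS.
Qed.

End LspanClosure.

Section BraidedSquare.
Variables (K : fieldType) (q : K) (O : K -> Prop).
Hypothesis hO : qadic q O.
Hypothesis q_inf : forall m : int, q ^ m = 1 -> m = 0.
Hypothesis two_neq0 : (1 + 1 : K) != 0.
Variables (I : finType) (M : uqgl2_module q I) (l : nat) (vb : nat -> coordspace K I).
Hypotheses (hM : in_Of M) (hv : standard_basis M l vb).
Variable c : nat -> K.
Hypothesis hc : universal_R q c.
Let q0 : q != 0 := qadic_neq0 hO.
Notation T := (coordspace K (I * I)%type).
Notation cfv := (cf l vb).
Notation cov := (co l vb).
Notation B := (braiding M M c).

Lemma cf_flip a b s : cfv a b (flip K I I s) = cfv b a s.
Proof.
rewrite /cf exchange_big; apply: eq_bigr => p _; apply: eq_bigr => r _ /=.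
by rewrite flipE mulrC [cov a _ * _]mulrC mulrC.
Qed.

Lemma cf_R0 a b s : cfv a b (R0 M M s) = q ^ ip (wt l a) (wt l b) * cfv a b s.
Proof.
have [ab|ab] := boolP ((l < a)%N || (l < b)%N); first by rewrite !cf_out ?mulr0.
rewrite {1}(cf_rec hv s) {2}(cf_rec hv s) !linear_sum /= mulr_sumr.
apply: eq_bigr => x _; rewrite !linear_sum /= mulr_sumr; apply: eq_bigr => y _.
rewrite !linearZ /= (R0P hM hM (sb_wt hv x) (sb_wt hv y)) linearZ /=.
rewrite cf_tens !(co_vb hv) ?leq_ord //.
case: eqP => [->|_]; last by rewrite !(mul0r, mulr0).
by case: eqP => [->|_]; rewrite ?(mulr0, mul0r) // mulrCA.
Qed.

Lemma cf_B_term a b k s : exists x,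
  cfv a b (tens_lfun (lfun_pow (opF M) k) (lfun_pow (opE M) k) s) =
     x * cfv (a - k) (b + k) s /\ ((a < k)%N -> x = 0).
Proof.
have [x [hx x0]] := co_powF hv k a; have [y hy] := co_powE hv k b.
exists (x * y); rewrite (cf_tens_lfun hx hy); split=> // ak.
by rewrite x0 ?mul0r.
Qed.

Lemma cf_B a b s : cfv a b (B s) = q ^ ip (wt l b) (wt l a) *
  \sum_(k < #|I|) c k * cfv b a (tens_lfun (lfun_pow (opF M) k) (lfun_pow (opE M) k) s).
Proof.
rewrite /braiding /Rmat !comp_lfunE cf_flip cf_R0; congr (_ * _).
rewrite sum_lfunE linear_sum; apply: eq_bigr => k _ /=.
by rewrite scale_lfunE linearZ.
Qed.

(** F^k adds k to the depth of the first factor and E^k removes k from that of the second. *)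
Lemma cf_B_depth s n :
  (forall a b, (a <= l)%N -> (b <= l)%N -> (a + b)%N = n -> cfv a b s = 0) ->
  forall a b, (a <= l)%N -> (b <= l)%N -> (a + b)%N = n -> cfv a b (B s) = 0.
Proof.
move=> h a b al bl abn; rewrite cf_B big1 ?mulr0 // => k _.
have [x [-> x0]] := cf_B_term b a k s.
have [bk|kb] := ltnP b k; first by rewrite x0 // mul0r mulr0.
have [la|al'] := ltnP l (a + k); first by rewrite cf_out ?la ?orbT // !mulr0.
by rewrite h ?mulr0 //; lia.
Qed.

Lemma card_I_gt0 : (0 < #|I|)%N.
Proof.
have := size_basis (sb_basis hv).
by rewrite dimvf /dim /= muln1 => ->.
Qed.

Lemma cf_B_first a b s : (forall k : nat, (0 < k)%N ->
    cfv b a (tens_lfun (lfun_pow (opF M) k) (lfun_pow (opE M) k) s) = 0) ->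
  cfv a b (B s) = q ^ ip (wt l b) (wt l a) * cfv b a s.
Proof.
move=> h; rewrite cf_B; congr (_ * _).
(* The truncated sum contains the term k = 0 because the index type is nonempty. *)
rewrite (bigD1 (Ordinal card_I_gt0)) //= hc.1 mul1r big1 ?addr0 => [|i i0].
  rewrite (cf_tens_lfun (c := 1) (d := 1) (a' := b) (b' := a)) ?mul1r //.
    by move=> u; rewrite lfun_pow0 mul1r.
  by move=> u; rewrite lfun_pow0 mul1r.
by rewrite h ?mulr0 // lt0n.
Qed.

Lemma braidingE s : B s = flip K I I (Rmat M M c s).
Proof. by rewrite /braiding comp_lfunE. Qed.

(** The flip turns R Delta = Delta^op R into commutation with Delta. *)
Lemma B_DeltaE s : B (DeltaE M M s) = DeltaE M M (B s).
Proof.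
have [h _ _] := hc.2 _ _ M M hM hM.
have := congr1 (fun f : 'End(T) => f s) h; rewrite comp_lfunE [RHS]comp_lfunE !braidingE => ->.
by rewrite /DeltaopE /DeltaE !add_lfunE linearD /= !flip_tens_lfun addrC.
Qed.

Lemma B_DeltaF s : B (DeltaF M M s) = DeltaF M M (B s).
Proof.
have [_ h _] := hc.2 _ _ M M hM hM.
have := congr1 (fun f : 'End(T) => f s) h; rewrite comp_lfunE [RHS]comp_lfunE !braidingE => ->.
by rewrite /DeltaopF /DeltaF !add_lfunE linearD /= !flip_tens_lfun addrC.
Qed.

Lemma B_DeltaK m s : B (DeltaK M M m s) = DeltaK M M m (B s).
Proof.
have [_ _ h] := hc.2 _ _ M M hM hM.
have := congr1 (fun f : 'End(T) => f s) (h m); rewrite comp_lfunE [RHS]comp_lfunE !braidingE => ->.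
by rewrite /DeltaopK /DeltaK !flip_tens_lfun.
Qed.

(* In these reversed coordinates the coproducts of E and F are exchanged. *)
Definition cfr (a b : nat) (w : T) : K :=
  if (a <= l)%N && (b <= l)%N then cfv (l - b) (l - a) w else 0.

Lemma cfr_scalar a b : scalar (cfr a b).
Proof.
by move=> x u v; rewrite /cfr; case: ifP => _; rewrite ?linearP //= mulr0 addr0.
Qed.
HB.instance Definition _ a b := GRing.isLinear.Build K T K *%R (cfr a b) (cfr_scalar a b).

Lemma odd_eigen_low s (z : int) : B s = (- q ^ z) *: s ->
  lowspan q l (fun a b => cfv a b s).
Proof.
apply: (@odd_eigen_lowspan _ q l O hO q_inf two_neq0 T (fun a b => cfv a b)
   (DeltaE M M) (DeltaF M M) B).
- exact: (cf_inj hv).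
- exact: (cf_surj hv).
- by move=> s' a b; apply: cf_out.
- by move=> s' a b _ _; apply: (cf_DeltaE hv).
- by move=> s' a b _ _; apply: (cf_DeltaF hv).
- exact: cf_B_depth.
- exact: B_DeltaE.
- exact: B_DeltaF.
(* The summands with k > 0 vanish because v_0 does not occur in the image of F. *)
- move=> n nl; exists (ip (wt l 0) (wt l n)) => s'.
  apply: cf_B_first => k k0.
  by have [x [-> ->]] := cf_B_term 0 n k s'; rewrite ?mul0r.
Qed.

Lemma odd_eigen_high s (z : int) : B s = (- q ^ z) *: s ->
  lowspan q l (fun a b => cfv (l - b) (l - a) s).
Proof.
move=> hs.
suff h : lowspan q l (fun a b => cfr a b s).
  move=> k kl; have [y hy] := h k kl; exists y => b bk; rewrite -hy // /cfr.
  by rewrite ifT //; lia.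
move: s z hs.
apply: (@odd_eigen_lowspan _ q l O hO q_inf two_neq0 T (fun a b => cfr a b)
   (DeltaF M M) (DeltaE M M) B).
- move=> s h; apply: (cf_inj hv) => a b al bl.
  have := h (l - b)%N (l - a)%N (leq_subr _ _) (leq_subr _ _).
  by rewrite /= /cfr !leq_subr /= !subKn.
- move=> f; have [s hs] := cf_surj hv (fun a b => f (l - b)%N (l - a)%N).
  by exists s => a b al bl; rewrite /= /cfr al bl /= hs ?leq_subr // !subKn.
- move=> s a b h; rewrite /= /cfr ifF //; lia.
- move=> s a b al bl; rewrite /= {1}/cfr al bl /= (cf_DeltaF hv) /dE /dF /cfr al bl.
  rewrite andbT /= addrC; congr (_ + _).
    case: ltnP => la; last by rewrite (_ : l - a = 0)%N ?mulr0 //; lia.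
    have -> : (l - a = (l - a.+1).+1)%N by lia.
    by congr (qbr q _ * _); lia.
  case: ltnP => lb; last by rewrite (_ : l - b = 0)%N ?mulr0 //; lia.
  have -> : (l - b = (l - b.+1).+1)%N by lia.
  rewrite [qbr q _ * _]mulrC; congr (q ^ _ * qbr q _ * _); lia.
- move=> s a b al bl; rewrite /= {1}/cfr al bl /= (cf_DeltaE hv) /dE /dF /cfr.
  rewrite addrC; congr (_ + _).
    case: a al => [|a] al; first by rewrite subn0 cf_out ?mulr0 // ltnSn orbT.
    rewrite (ltnW al) bl /=; have -> : ((l - a.+1).+1 = l - a)%N by lia.
    rewrite [q ^ _ * _]mulrC; congr (qbr q _ * q ^ _ * _); lia.
  case: b bl => [|b] bl; first by rewrite subn0 cf_out ?mulr0 // ltnSn.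
  rewrite al (ltnW bl) /=; have -> : ((l - b.+1).+1 = l - b)%N by lia.
  by congr (qbr q _ * _); lia.
- move=> s n h a b al bl abn; rewrite /= /cfr al bl /=.
  apply: (@cf_B_depth s (l - b + (l - a))); rewrite ?leq_subr //.
  move=> a' b' al' bl' e; have := h (l - b')%N (l - a')%N.
  by rewrite /= /cfr !leq_subr /= !subKn //; apply=> //; lia.
- exact: B_DeltaF.
- exact: B_DeltaE.
(* Here they vanish because v_l does not occur in the image of E. *)
- move=> n nl; exists (ip (wt l (l - n)) (wt l l)) => s.
  rewrite /= /cfr nl leq0n /= subn0.
  apply: cf_B_first => k k0.
  have [x [-> _]] := cf_B_term (l - n) l k s.
  by rewrite cf_out ?mulr0 //; apply/orP; right; lia.
Qed.

Lemma lowspan0 : lowspan q l (fun _ _ => 0).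
Proof.
by move=> k kl; exists (fun=> 0) => b bk; rewrite big1 // => i _; rewrite mul0r.
Qed.

Lemma lowspan_lin x f g : lowspan q l f -> lowspan q l g ->
  lowspan q l (fun a b => x * f a b + g a b).
Proof.
move=> hf hg k kl; have [y hy] := hf k kl; have [z hz] := hg k kl.
exists (fun n => x * y n + z n) => b bk; rewrite (hy b bk) (hz b bk).
by rewrite mulr_sumr -big_split; apply: eq_bigr => i _ /=; ring.
Qed.

Definition sq_coords (f : nat -> nat -> K) : Prop :=
  exists2 s, ext_square c M s & f = (fun a b => cfv a b s).

Lemma ext_square_stable (D : 'End(T)) s : (forall s, B (D s) = D (B s)) ->
  ext_square c M s -> ext_square c M (D s).
Proof.
move=> BD; move: s; apply: lspan_ind.
- move=> s [k hk]; apply: lspan_sub; exists k.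
  by rewrite BD hk linearZ.
- by rewrite linear0; apply: lspan0.
- by move=> x s s' hs hs'; rewrite linearP; apply: lspanD => //; apply: lspanZ.
Qed.

Lemma sq_L4_eq0 t : L4 sq_coords t -> forall a b d e, t a b d e = 0.
Proof.
apply: (L4_eq0 hO).
- move=> x f g [s hs ->] [s' hs' ->]; exists (x *: s + s').
    by apply: lspanD => //; apply: lspanZ.
  by apply/funext => a; apply/funext => b; rewrite linearP.
- by move=> f a b [s _ ->]; apply: cf_out.
- move=> f [s hs ->]; exists (DeltaE M M s).
    by apply: ext_square_stable => //; apply: B_DeltaE.
  by apply/funext => a; apply/funext => b; rewrite (cf_DeltaE hv).
- move=> f [s hs ->]; exists (DeltaF M M s).
    by apply: ext_square_stable => //; apply: B_DeltaF.
  by apply/funext => a; apply/funext => b; rewrite (cf_DeltaF hv).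
- move=> m f [s hs ->]; exists (DeltaK M M (0, m) s).
    by apply: ext_square_stable => //; apply: B_DeltaK.
  by apply/funext => a; apply/funext => b; rewrite (cf_DeltaK hv q0).
- move=> _ [s hs ->]; move: s hs; apply: lspan_ind.
  + by move=> s [k hk]; apply: odd_eigen_low hk.
  + by have := lowspan0; congr (lowspan _ _ _); apply/funext => a; apply/funext => b; rewrite linear0.
  + move=> x s s' hs hs'; have := lowspan_lin x hs hs'; congr (lowspan _ _ _).
    by apply/funext => a; apply/funext => b; rewrite linearP.
- move=> _ [s hs ->]; move: s hs; apply: lspan_ind.
  + by move=> s [k hk]; apply: odd_eigen_high hk.
  + by have := lowspan0; congr (lowspan _ _ _); apply/funext => a; apply/funext => b; rewrite linear0.
  + move=> x s s' hs hs'; have := lowspan_lin x hs hs'; congr (lowspan _ _ _).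
    by apply/funext => a; apply/funext => b; rewrite linearP.
Qed.

End BraidedSquare.

(** * The field C(q) and tensor powers *)

Lemma frac_numden (R : idomainType) (x : {fraction R}) :
  exists n d : R, d != 0 /\ x = tofrac n / tofrac d.
Proof.
elim/quotW: x => x; exists \n_x, \d_x; split; first exact: denom_ratioP.
have d0 : tofrac \d_x != 0 :> {fraction R} by rewrite tofrac_eq0 denom_ratioP.
apply: (mulIf d0); rewrite divfK //; unlock FracField.tofrac.
rewrite -[LHS]FracField.pi_mul; apply/eqmodP; rewrite /= FracField.equivfE /FracField.mulf.
by rewrite !numden_Ratio ?mulf_neq0 ?denom_ratioP ?oner_eq0 // !mulr1 mulrC.
Qed.

Lemma cross_mul (F : fieldType) (q f g f' g' : F) (N : int) :
  q != 0 -> g != 0 -> g' != 0 -> q ^ (- N) * (f / g) = f' / g' ->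
  f * g' = q ^ N * (f' * g).
Proof.
move=> q0 g0 g0' e; have -> : f = q ^ N * (f' / g') * g.
  by rewrite -e mulrA -expfzDr // subrr expr0z mul1r divfK.
by field.
Qed.

Section QadicFractions.
Variable k : fieldType.
Notation F := {fraction {poly k}}.

(** The local ring of k(X) at X = 0. *)
Definition regular0 (x : F) : Prop :=
  exists f g : {poly k}, g.[0] != 0 /\ x = tofrac f / tofrac g.

Lemma tofrac_horner_neq0 (g : {poly k}) : g.[0] != 0 -> tofrac g != 0 :> F.
Proof. by rewrite tofrac_eq0; apply: contra => /eqP ->; rewrite horner0. Qed.

Lemma qadic_regular0 : qadic (tofrac 'X : F) regular0.
Proof.
have X0 : tofrac 'X != 0 :> F by rewrite tofrac_eq0 polyX_eq0.
split=> //.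
- by exists 1, 1; rewrite hornerC oner_neq0 tofrac1 divr1.
- move=> _ _ [f [g [g0 ->]]] [f' [g' [g0' ->]]].
  exists (f * g' - f' * g), (g * g'); rewrite hornerM mulf_neq0 //; split=> //.
  rewrite -mulNr addf_div ?tofrac_horner_neq0 // tofracB.
  by rewrite (tofracM f g') (tofracM f' g) (tofracM g g') mulNr.
- move=> _ _ [f [g [g0 ->]]] [f' [g' [g0' ->]]].
  exists (f * f'), (g * g'); rewrite hornerM mulf_neq0 //; split=> //.
  by rewrite mulf_div (tofracM f f') (tofracM g g').
- by exists 'X, 1; rewrite hornerC oner_neq0 tofrac1 divr1.
- move=> _ [f [g [g0 ->]]].
  have gf0 : (g + 'X * f).[0] != 0 by rewrite hornerD hornerM hornerX mul0r addr0.
  have e : 1 + tofrac 'X * (tofrac f / tofrac g) = tofrac (g + 'X * f) / tofrac g :> F.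
    by rewrite tofracD (tofracM 'X f) mulrDl mulfV ?tofrac_horner_neq0 // mulrA.
  rewrite e mulf_neq0 ?invr_eq0 ?tofrac_horner_neq0 //; split=> //.
  by exists g, (g + 'X * f); rewrite invf_div.
- move=> x; have [f [g [g0 ->]]] := frac_numden x.
  (* The exponent is the multiplicity of the root 0 in the denominator. *)
  have [m [h]] := multiplicity_XsubC g 0; rewrite g0 /= subr0 => h0 ->.
  exists m, f, h; split; first exact: h0.
  rewrite (tofracM h) tofracXn -exprnP invfM mulrCA [X in _ * X]mulrCA.
  by rewrite (mulfV (expf_neq0 m X0)) mulr1.
- move=> x; have [f [g [g0 ->]]] := frac_numden x => h.
  have [->|f0] := eqVneq f 0; first by rewrite tofrac0 mul0r.
  (* For N = [size f], regularity of q^(-N) x makes X^N divide f, which exceeds its degree. *)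
  have [f' [g' [g0' e]]] := h (size f).
  have g00 : tofrac g != 0 :> F by rewrite tofrac_eq0.
  have : tofrac (f * g') = tofrac ('X ^+ size f * (f' * g)) :> F.
    rewrite (tofracM f) (tofracM ('X ^+ _)) (tofracM f') tofracXn exprnP.
    exact: (cross_mul X0 g00 (tofrac_horner_neq0 g0') e).
  move/eqP; rewrite tofrac_eq => /eqP e'.
  have : 'X ^+ size f %| f.
    rewrite -(@Gauss_dvdpl _ _ g') ?e' ?dvdp_mulr //.
    by rewrite coprimep_expl // coprimep_sym -['X]subr0 coprimep_XsubC.
  by move/(dvdp_leq f0); rewrite size_polyXn ltnn.
Qed.

End QadicFractions.

Lemma Cq_two_neq0 (R : realType) : (1 + 1 : Cq R) != 0.
Proof.
rewrite -tofrac1 -tofracD tofrac_eq0 -polyCD polyC_eq0.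
by rewrite -[1 + 1]/(2%:R) pnatr_eq0.
Qed.

(** * Two-slot slices of a tensor *)

Section Slots.
Variables (K : fieldType) (I : finType) (n : nat).
Notation T := (coordspace K (I * I)%type).

(** On a spanning tensor, freezing the other indices at z leaves a scalar multiple of w. *)
Lemma tens_slot_slice (i j : 'I_n) (S : set T) (t : tenspow K I n)
    (y : I -> I -> {ffun 'I_n -> I}) (z : 'I_n -> I) :
  (forall p r, y p r i = p) -> (forall p r, y p r j = r) ->
  (forall p r k, k != i -> k != j -> y p r k = z k) ->
  tens_slot i j (lspan S) t -> lspan S [ffun pr => t (y pr.1 pr.2)].
Proof.
move=> yi yj yk; move: t; apply: lspan_ind.
- move=> _ [w [v [hw ->]]].
  have -> : [ffun pr => tens_insert i j w v (y pr.1 pr.2)] =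
      (\prod_(k < n | (k != i) && (k != j)) (v k (z k) : K)) *: w.
    apply/ffunP => -[p r]; rewrite !ffunE /= yi yj [in RHS]/GRing.scale /= mulrC.
    by congr (_ * _); apply: eq_bigr => k /andP[ki kj]; rewrite yk.
  exact: lspanZ.
- have -> : [ffun pr => (0 : tenspow K I n) (y pr.1 pr.2)] = 0 :> T.
    by apply/ffunP => pr; rewrite !ffunE.
  exact: lspan0.
- move=> c s s' hs hs'.
  have -> : [ffun pr => (c *: s + s') (y pr.1 pr.2)] =
     c *: [ffun pr => s (y pr.1 pr.2)] + [ffun pr => s' (y pr.1 pr.2)] :> T.
    by apply/ffunP => pr; rewrite !ffunE.
  by apply: lspanD => //; apply: lspanZ.
Qed.

End Slots.

(** * From index tensors to coefficients in the standard basis *)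

Section FourSlots.
Variables (K : fieldType) (q : K) (O : K -> Prop).
Hypothesis hO : qadic q O.
Hypothesis q_inf : forall m : int, q ^ m = 1 -> m = 0.
Hypothesis two_neq0 : (1 + 1 : K) != 0.
Variables (I : finType) (M : uqgl2_module q I) (l : nat) (vb : nat -> coordspace K I).
Hypotheses (hM : in_Of M) (hv : standard_basis M l vb).
Variable c : nat -> K.
Hypothesis hc : universal_R q c.
Notation cop a p := (co l vb a (stdvec K p)).

Lemma co_vec_eq0 (g : I -> K) :
  (forall a, \sum_p g p * cop a p = 0) -> forall p, g p = 0.
Proof.
move=> h p; pose u : coordspace K I := [ffun p => g p].
have : u = 0.
  rewrite (co_sum hv u) big1 // => a _; rewrite [X in X *: _](_ : _ = 0) ?scale0r //.
  rewrite -[RHS](h a) (stdvecE u) linear_sum /=; apply: eq_bigr => p' _.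
  by rewrite linearZ /= ffunE.
by move/ffunP => /(_ p); rewrite !ffunE.
Qed.

(** The sums are nested so that [co_vec_eq0] can remove one slot at a time. *)
Definition contract (t : I -> I -> I -> I -> K) (a b d e : nat) : K :=
  \sum_p (\sum_r (\sum_s (\sum_u t p r s u * cop e u) * cop d s) * cop b r) * cop a p.

Lemma contract_eq0 t : (forall a b d e, contract t a b d e = 0) ->
  forall p r s u, t p r s u = 0.
Proof.
move=> h p r s u; move: u; apply: co_vec_eq0 => e; move: s; apply: co_vec_eq0 => d.
move: r; apply: co_vec_eq0 => b; move: p; apply: co_vec_eq0 => a.
exact: h.
Qed.

Lemma sq_sum2 (w : I -> I -> coordspace K (I * I)%type) (x y : I -> K) :
  (forall p r, ext_square c M (w p r)) ->
  sq_coords M l vb c (fun a b => \sum_p \sum_r (x p * y r) * cf l vb a b (w p r)).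
Proof.
move=> hw; exists (\sum_p \sum_r (x p * y r) *: w p r).
  by apply: lspan_sum => p _; apply: lspan_sum => r _; apply: lspanZ; apply: hw.
apply/funext => a; apply/funext => b; rewrite linear_sum /=; apply: eq_bigr => p _.
by rewrite linear_sum /=; apply: eq_bigr => r _; rewrite linearZ.
Qed.

Lemma contractE t a b d e : contract t a b d e =
  \sum_p \sum_r \sum_s \sum_u t p r s u * (cop a p * cop b r * (cop d s * cop e u)).
Proof.
rewrite /contract; apply: eq_bigr => p _; rewrite mulr_suml; apply: eq_bigr => r _.
rewrite !mulr_suml; apply: eq_bigr => s _; rewrite !mulr_suml.
by apply: eq_bigr => u _; ring.
Qed.

Lemma sum4_exchange (F : I -> I -> I -> I -> K) :
  \sum_p \sum_r \sum_s \sum_u F p r s u = \sum_s \sum_u \sum_p \sum_r F p r s u.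
Proof.
rewrite pair_bigA exchange_big /=; apply: eq_bigr => s _.
rewrite exchange_big /=; apply: eq_bigr => u _.
by rewrite (pair_bigA _ (fun p r => F p r s u)).
Qed.

Lemma sum3_exchange (F : I -> I -> I -> K) :
  \sum_r \sum_s \sum_u F r s u = \sum_u \sum_r \sum_s F r s u.
Proof.
rewrite pair_bigA exchange_big /=; apply: eq_bigr => u _.
by rewrite (pair_bigA _ (fun r s => F r s u)).
Qed.

Lemma four_slots_eq0 (t : I -> I -> I -> I -> K) :
  (forall s u, ext_square c M [ffun pr => t pr.1 pr.2 s u]) ->
  (forall p u, ext_square c M [ffun pr => t p pr.1 pr.2 u]) ->
  (forall p r, ext_square c M [ffun pr => t p r pr.1 pr.2]) ->
  forall p r s u, t p r s u = 0.
Proof.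
move=> t12 t23 t34; apply: contract_eq0.
apply: (sq_L4_eq0 hO q_inf two_neq0 hM hv hc).
have h34 a b : sq_coords M l vb c (contract t a b).
  have := sq_sum2 (fun p => cop a p) (fun r => cop b r) t34; congr (sq_coords _ _ _ _ _).
  apply/funext => d; apply/funext => e; rewrite contractE.
  apply: eq_bigr => p _; apply: eq_bigr => r _; rewrite /cf mulr_sumr.
  apply: eq_bigr => s _; rewrite mulr_sumr; apply: eq_bigr => u _.
  by rewrite ffunE /=; ring.
have h23 a e : sq_coords M l vb c (fun b d => contract t a b d e).
  have := sq_sum2 (fun p => cop a p) (fun u => cop e u) t23; congr (sq_coords _ _ _ _ _).
  apply/funext => b; apply/funext => d; rewrite contractE.
  apply: eq_bigr => p _.
  rewrite sum3_exchange; apply: eq_bigr => u _; rewrite /cf mulr_sumr.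
  apply: eq_bigr => r _; rewrite mulr_sumr; apply: eq_bigr => s _.
  by rewrite ffunE /=; ring.
have h12 d e : sq_coords M l vb c (fun a b => contract t a b d e).
  have := sq_sum2 (fun s => cop d s) (fun u => cop e u) t12; congr (sq_coords _ _ _ _ _).
  apply/funext => a; apply/funext => b; rewrite contractE sum4_exchange.
  apply: eq_bigr => s _; apply: eq_bigr => u _; rewrite /cf mulr_sumr.
  apply: eq_bigr => p _; rewrite mulr_sumr; apply: eq_bigr => r _.
  by rewrite ffunE /=; ring.
by split=> x; split=> y.
Qed.

End FourSlots.

Local Open Scope classical_set_scope.

Theorem theorem2p34 (R : realType) (c : nat -> Cq R)
  (hc : universal_R (qvar R) c) (l n : nat) (hl : (3 <= l)%N) (hn : (4 <= n)%N)
  (I : finType) (M : uqgl2_module (qvar R) I)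
  (hO : in_Of M) (hsimple : simple_module M)
  (hweight : has_highest_weight M (l%:Z, 0)) :
  ext_power c M n = [set 0].
Proof.
have [v0 [/eqP v0_neq0 v0_wt v0E]] := hweight.
have qad : qadic (qvar R) (@regular0 R[i]) by apply: qadic_regular0.
have qinf := @qvar_inf R.
have hv := vb_standard qad qinf v0_neq0 v0_wt v0E hsimple.
apply/seteqP; split=> t; last first.
  move=> -> i j _; exact: lspan0.
move=> ht; apply/ffunP => x; rewrite [RHS]ffunE.
pose s k (kn : (k < 4)%N) : 'I_n := Ordinal (leq_trans kn hn).
pose s0 := s 0%N isT; pose s1 := s 1%N isT; pose s2 := s 2%N isT; pose s3 := s 3%N isT.
(* All slots beyond the fourth stay frozen at the index x. *)
pose y (p r u w : I) : {ffun 'I_n -> I} := [ffun k : 'I_n =>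
  if k == s0 then p else if k == s1 then r else if k == s2 then u else
  if k == s3 then w else x k].
have -> : x = y (x s0) (x s1) (x s2) (x s3).
  by apply/ffunP => k; rewrite ffunE; do 4?[case: eqP => [->//|_]].
have h := @four_slots_eq0 _ _ _ qad qinf (Cq_two_neq0 R) _ _ _ _ hO hv _ hc
  (fun p r u w => t (y p r u w)).
apply: h => [u w|p w|p r].
- apply: (@tens_slot_slice _ _ _ s0 s1 _ t (fun p r => y p r u w) (y u u u w)).
  + by move=> p r; rewrite ffunE.
  + by move=> p r; rewrite ffunE.
  + by move=> p r k /negbTE k0 /negbTE k1; rewrite !ffunE k0 k1.
  + exact: ht.
- apply: (@tens_slot_slice _ _ _ s1 s2 _ t (fun r u => y p r u w) (y p p p w)).
  + by move=> r u; rewrite ffunE.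
  + by move=> r u; rewrite ffunE.
  + by move=> r u k /negbTE k0 /negbTE k1; rewrite !ffunE k0 k1.
  + exact: ht.
- apply: (@tens_slot_slice _ _ _ s2 s3 _ t (fun u w => y p r u w) (y p r p p)).
  + by move=> u w; rewrite ffunE.
  + by move=> u w; rewrite ffunE.
  + by move=> u w k /negbTE k0 /negbTE k1; rewrite !ffunE k0 k1.
  + exact: ht.
Qed.
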